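(* The operator $L$ (defined in the context) is self-adjoint in the Hilbert space $\mathcal H$.
   Context: Let $a,b>0$, $q\in L^2(-a,b)$, $\alpha\in[0,\pi)$, $\beta\in(0,\pi]$, and $\ell y:=-y''+qy$. Let $N,M\in\mathbb{N}_0$ (empty sums are $0$), $\eta,\kappa\ge 0$, $\xi,\zeta\in\mathbb{R}$, real numbers $c_1<\dots<c_N$ and $d_1<\dots<d_M$, and $b_i>0$ ($i=1,\dots,N$), $a_j>0$ ($j=1,\dots,M$). Put $$\mu(\lambda)=-\Big(\lambda\eta-\xi-\sum_{i=1}^N\frac{b_i^2}{\lambda-c_i}\Big),\qquad \nu(\lambda)=\lambda\kappa+\zeta-\sum_{j=1}^M\frac{a_j^2}{\lambda-d_j}.$$ If $\eta>0$ write $\frac1{\mu(\lambda)}=\sigma-\sum_{i=1}^{N'}\frac{\beta_i^2}{\lambda-\gamma_i}$ with $N'\in\mathbb{N}$, $\gamma_1<\dots<\gamma_{N'}$, $\beta_i>0$; if $\kappa>0$ write $\frac1{\nu(\lambda)}=\tau+\sum_{j=1}^{M'}\frac{\alpha_j^2}{\lambda-\delta_j}$ with $M'\in\mathbb{N}$, $\delta_1<\dots<\delta_{M'}$, $\alpha_j>0$. Bold letters denote vectors: $\boldsymbol\beta=(\beta_i)$, $\boldsymbol\alpha=(\alpha_j)$, $\mathbf b=(b_i)$, $\mathbf a=(a_j)$; $[\gamma_i],[\delta_j],[c_i],[d_j]$ denote the corresponding diagonal matrices. For a function $y$ on $(-a,0)\cup(0,b)$ write $y(0^\pm),y'(0^\pm)$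 for one-sided limits at $0$, $\Delta y=y(0^+)-y(0^-)$, $\Delta' y=y'(0^+)-y'(0^-)$. Operator $L$: let $\mathcal H=L^2(-a,b)\oplus\mathbb{C}^{N^*}\oplus\mathbb{C}^{M^*}$, where $N^*=N'$ if $\eta>0$, $N^*=N$ if $\eta=0$, $M^*=M'$ if $\kappa>0$, $M^*=M$ if $\kappa=0$, with inner product $\langle Y,Z\rangle=\int_{-a}^b y\bar z\,dx+\langle\mathbf y^1,\mathbf z^1\rangle+\langle\mathbf y^2,\mathbf z^2\rangle$ (Euclidean inner products on the last two components). For $Y=(y,\mathbf y^1,\mathbf y^2)$ set $LY=(\ell y,[LY]_1,[LY]_2)$, where $[LY]_1=\boldsymbol\beta\Delta' y+[\gamma_i]\mathbf y^1$ if $\eta>0$, $[LY]_1=\mathbf b\,y(0^+)+[c_i]\mathbf y^1$ if $\eta=0$; $[LY]_2=\boldsymbol\alpha\Delta y+[\delta_j]\mathbf y^2$ if $\kappa>0$, $[LY]_2=\mathbf a\,y'(0^-)+[d_j]\mathbf y^2$ if $\kappa=0$. The domain $\mathcal D(L)$ consists of all $Y\in\mathcal H$ such that $y_1:=y|_{(-a,0)}$ has $y_1,y_1',\ell y_1\in L^2(-a,0)$ and $y(-a)\cos\alpha=y'(-a)\sin\alpha$; $y_2:=y|_{(0,b)}$ has $y_2,y_2',\ell y_2\in L^2(0,b)$ and $y(b)\cos\beta=y'(b)\sin\beta$; $-y(0^+)+\sigma\Delta' y-\langle\mathbf y^1,\boldsymbol\beta\rangle=0$ if $\eta>0$, $\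 \Delta' y-\xi y(0^+)-\langle\mathbf y^1,\mathbf b\rangle=0$ if $\eta=0$; $y'(0^-)-\tau\Delta y-\langle\mathbf y^2,\boldsymbol\alpha\rangle=0$ if $\kappa>0$, $\ -\Delta y+\zeta y'(0^-)-\langle\mathbf y^2,\mathbf a\rangle=0$ if $\kappa=0$.
   Formalization: The potential q is taken to be real-valued; for complex-valued q in L²(-a,b) (for example q = i) the operator L is not symmetric, and self-adjointness holds only if q is real almost everywhere. *)

(* Defs.v *)
From mathcomp Require Import all_boot all_order all_algebra.
From mathcomp Require Import all_classical all_reals all_analysis.
From mathcomp Require Import complex.

Set Implicit Arguments.
Unset Strict Implicit.
Unset Printing Implicit Defensive.

Import Order.TTheory GRing.Theory Num.Theory.
Import numFieldNormedType.Exports.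

Local Open Scope classical_set_scope.
Local Open Scope ring_scope.
Local Open Scope complex_scope.

Definition Cre (R : realType) (f : R -> R[i]) : R -> R := fun x => complex.Re (f x).
Definition Cim (R : realType) (f : R -> R[i]) : R -> R := fun x => complex.Im (f x).

Definition Cintegral (R : realType) (D : set R) (f : R -> R[i]) : R[i] :=
  (\int[lebesgue_measure]_(x in D) Cre f x)%R
  +i* (\int[lebesgue_measure]_(x in D) Cim f x)%R.

Definition lim_right (R : realType) (f : R -> R[i]) (x : R) : R[i] :=
  lim (Cre f t @[t --> x^'+]) +i* lim (Cim f t @[t --> x^'+]).

Definition lim_left (R : realType) (f : R -> R[i]) (x : R) : R[i] :=
  lim (Cre f t @[t --> x^'-]) +i* lim (Cim f t @[t --> x^'-]).

(** Square integrability on (l, r) only: the restriction [\_] is 0 outside. *)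
Definition L2on (R : realType) (l r : R) (f : R -> R) : Prop :=
  f \_ `]l, r[ \in Lfun (@lebesgue_measure R) 2%:E.

Definition CL2on (R : realType) (l r : R) (f : R -> R[i]) : Prop :=
  L2on l r (Cre f) /\ L2on l r (Cim f).

(** [f] is locally absolutely continuous on (l, r) with derivative [f'] (which
    is determined up to a null set): [f] is an indefinite integral of the
    locally integrable function [f']. *)
Definition ac_deriv (R : realType) (l r : R) (f f' : R -> R) : Prop :=
  locally_integrable `]l, r[ f' /\
  forall s t : R, l < s -> s <= t -> t < r ->
    f t - f s = (\int[lebesgue_measure]_(x in `[s, t]) f' x)%R.

Definition Cac_deriv (R : realType) (l r : R) (f f' : R -> R[i]) : Prop :=
  ac_deriv l r (Cre f) (Cre f') /\ ac_deriv l r (Cim f) (Cim f').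

Definition lebesgue_on (R : realType) (l r : R) :
    {measure set (measurableTypeR R) -> \bar R} :=
  mrestr (@lebesgue_measure R) (measurable_itv `]l, r[).

(** The L^2 component is [hre + i him], where [hre] and [him] are elements of
    the real space L^2(-a, b) of the library, i.e. classes of functions modulo
    almost everywhere equality. *)
Record hspace (R : realType) (a b : R) (n m : nat) := HVec {
  hre : LspaceType2 (lebesgue_on (- a) b);
  him : LspaceType2 (lebesgue_on (- a) b);
  hv1 : 'rV[R[i]]_n;
  hv2 : 'rV[R[i]]_m }.

Definition hfun (R : realType) (a b : R) (n m : nat) (Y : hspace a b n m) :
  R -> R[i] := fun x => (hre Y x : R) +i* (him Y x : R).

Definition cdot (R : realType) (n : nat) (v w : 'rV[R[i]]_n) : R[i] :=
  \sum_(i < n) v 0 i * (w 0 i)^*.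

Definition pre_inner (R : realType) (a b : R) (n m : nat)
    (y : R -> R[i]) (y1 : 'rV[R[i]]_n) (y2 : 'rV[R[i]]_m)
    (z : R -> R[i]) (z1 : 'rV[R[i]]_n) (z2 : 'rV[R[i]]_m) : R[i] :=
  Cintegral `](- a), b[ (fun x => y x * (z x)^*) + cdot y1 z1 + cdot y2 z2.

Definition inner (R : realType) (a b : R) (n m : nat) (Y Z : hspace a b n m) :
    R[i] :=
  pre_inner a b (hfun Y) (hv1 Y) (hv2 Y) (hfun Z) (hv1 Z) (hv2 Z).

(** The norm of [Y - Z]. *)
Definition hdist (R : realType) (a b : R) (n m : nat) (Y Z : hspace a b n m) : R :=
  let y := fun x => hfun Y x - hfun Z x in
  let y1 := hv1 Y - hv1 Z in
  let y2 := hv2 Y - hv2 Z in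
  Num.sqrt (complex.Re (pre_inner a b y y1 y2 y y1 y2)).

(** An operator [T] in [hspace a b n m] is given by its graph: [T Y W] means
    that [Y] is in the domain of [T] and that [T Y = W]. *)
Definition densely_defined (R : realType) (a b : R) (n m : nat)
    (T : hspace a b n m -> hspace a b n m -> Prop) : Prop :=
  forall (Y : hspace a b n m) (e : R), 0 < e ->
    exists Z, (exists W, T Z W) /\ hdist Y Z < e.

Definition adjoint (R : realType) (a b : R) (n m : nat)
    (T : hspace a b n m -> hspace a b n m -> Prop) :
    hspace a b n m -> hspace a b n m -> Prop :=
  fun Z W => forall Y V, T Y V -> inner V Z = inner Y W.

(** Density makes [adjoint T] single-valued and linear, so that a relation
    satisfying [self_adjoint] is the graph of a linear operator. *)
Definition self_adjoint (R : realType) (a b : R) (n m : nat)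
    (T : hspace a b n m -> hspace a b n m -> Prop) : Prop :=
  densely_defined T /\ forall Z W, T Z W <-> adjoint T Z W.

Definition mu_fun (R : realType) (N : nat) (eta xi : R) (bv c : 'I_N -> R)
    (lambda : R) : R :=
  - (lambda * eta - xi - \sum_(i < N) bv i ^+ 2 / (lambda - c i)).

Definition nu_fun (R : realType) (M : nat) (kappa zeta : R) (av d : 'I_M -> R)
    (lambda : R) : R :=
  lambda * kappa + zeta - \sum_(j < M) av j ^+ 2 / (lambda - d j).

(** [1 / mu = sigma - sum_i betav_i ^ 2 / (lambda - gamma_i)] as rational
    functions: the identity is required wherever both sides are defined. *)
Definition mu_inv_expansion (R : realType) (N N' : nat) (eta xi : R)
    (bv c : 'I_N -> R) (sigma : R) (betav gamma : 'I_N' -> R) : Prop :=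
  [/\ (0 < N')%N,
      (forall i j : 'I_N', (i < j)%N -> gamma i < gamma j),
      (forall i, 0 < betav i) &
      forall lambda : R,
        (forall i, lambda <> c i) -> (forall i, lambda <> gamma i) ->
        mu_fun eta xi bv c lambda <> 0 ->
        1 / mu_fun eta xi bv c lambda =
          sigma - \sum_(i < N') betav i ^+ 2 / (lambda - gamma i)].

Definition nu_inv_expansion (R : realType) (M M' : nat) (kappa zeta : R)
    (av d : 'I_M -> R) (tau : R) (alphav delta : 'I_M' -> R) : Prop :=
  [/\ (0 < M')%N,
      (forall i j : 'I_M', (i < j)%N -> delta i < delta j),
      (forall j, 0 < alphav j) &
      forall lambda : R,
        (forall j, lambda <> d j) -> (forall j, lambda <> delta j) ->
        nu_fun kappa zeta av d lambda <> 0 ->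
        1 / nu_fun kappa zeta av d lambda =
          tau + \sum_(j < M') alphav j ^+ 2 / (lambda - delta j)].

(** The boolean [s] is [0 < eta] (resp. [0 < kappa]): N^* is N' or N, and the
    vectors attached to the poles are (beta_i), (gamma_i) or (b_i), (c_i). *)
Definition star_dim (s : bool) (n' n : nat) : nat := if s then n' else n.

Definition star_vec (R : realType) (s : bool) (n' n : nat)
    (u : 'I_n' -> R) (v : 'I_n -> R) : 'I_(star_dim s n' n) -> R :=
  match s as s0 return 'I_(star_dim s0 n' n) -> R with
  | true => u
  | false => v
  end.
Arguments star_vec {R} s {n' n} u v.

Definition realv (R : realType) (n : nat) (u : 'I_n -> R) : 'rV[R[i]]_n :=
  \row_i (u i)%:C.

Definition diagv (R : realType) (n : nat) (u : 'I_n -> R) : 'M[R[i]]_n :=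
  diag_mx (realv u).

Definition ell_regular (R : realType) (q : R -> R) (l r : R)
    (y y' y'' : R -> R[i]) : Prop :=
  [/\ Cac_deriv l r y y', Cac_deriv l r y' y'',
      CL2on l r y, CL2on l r y' &
      CL2on l r (fun x => - y'' x + (q x)%:C * y x)].

(** [opL ... Y W] means that [Y] is in D(L) and [L Y = W]. The function [y] is
    the representative of the L^2 component of [Y] which is locally absolutely
    continuous together with [y'] on each of (-a, 0) and (0, b).  The values of
    [y] and [y'] at [-a], [0-], [0+] and [b] are one-sided limits, which
    exist under [ell_regular]. *)
Definition opL (R : realType) (a b : R) (q : R -> R) (alpha beta : R)
    (N M N' M' : nat) (eta kappa xi zeta : R)
    (c bv : 'I_N -> R) (d av : 'I_M -> R)
    (sigma : R) (gamma betav : 'I_N' -> R)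
    (tau : R) (delta alphav : 'I_M' -> R)
    (Y W : hspace a b (star_dim (0 < eta) N' N) (star_dim (0 < kappa) M' M)) :
    Prop :=
  exists y y' y'' : R -> R[i],
    let yp := lim_right y 0 in
    let y'm := lim_left y' 0 in
    let Dy := lim_right y 0 - lim_left y 0 in
    let Dy' := lim_right y' 0 - lim_left y' 0 in
    let w1 := realv (star_vec (0 < eta) betav bv) in
    let D1 := diagv (star_vec (0 < eta) gamma c) in
    let w2 := realv (star_vec (0 < kappa) alphav av) in
    let D2 := diagv (star_vec (0 < kappa) delta d) in
    [/\ [/\ {ae lebesgue_measure, forall x : R, x \in `](- a), b[ -> hfun Y x = y x},
            ell_regular q (- a) 0 y y' y'' &
            ell_regular q 0 b y y' y''],
        lim_right y (- a) * (cos alpha)%:C = lim_right y' (- a) * (sin alpha)%:C /\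
        lim_left y b * (cos beta)%:C = lim_left y' b * (sin beta)%:C,
        (if 0 < eta
         then - yp + sigma%:C * Dy' - cdot (hv1 Y) w1 = 0
         else Dy' - xi%:C * yp - cdot (hv1 Y) w1 = 0),
        (if 0 < kappa
         then y'm - tau%:C * Dy - cdot (hv2 Y) w2 = 0
         else - Dy + zeta%:C * y'm - cdot (hv2 Y) w2 = 0) &
        [/\ {ae lebesgue_measure, forall x : R, x \in `](- a), b[ ->
               hfun W x = - y'' x + (q x)%:C * y x},
            hv1 W = (if 0 < eta then Dy' else yp) *: w1 + hv1 Y *m D1 &
            hv2 W = (if 0 < kappa then Dy else y'm) *: w2 + hv2 Y *m D2]].

(* Main.v *)
Require Import Defs.
From mathcomp Require Import all_boot all_order all_algebra.
From mathcomp Require Import all_classical all_reals all_analysis.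
From mathcomp Require Import measurable_realfun.
From mathcomp Require Import complex ring lra.

Set Implicit Arguments.
Unset Strict Implicit.
Unset Printing Implicit Defensive.

Import Order.TTheory GRing.Theory Num.Theory.
Import numFieldNormedType.Exports.

Local Open Scope classical_set_scope.
Local Open Scope ring_scope.

(** All coefficients are real, so the operator acts separately on real and
    imaginary parts ([opL_parts], [opL_of_parts]), and symmetry, maximality and
    density reduce to statements about real functions on the two sides of 0,
    proved by integration by parts and explicit test functions.

    Symmetry. Green's formula on both sides of 0 ([green], which rests on the
    integration by parts [abscont_by_parts] for absolutely continuous functions)
    leaves boundary terms only. Those at [- a] and [b] vanish by the boundary
    conditions. Those at 0 are a sum of two symplectic forms, one in
    [(y(0+), jump of y')] and one in [(y'(0-), jump of y)] ([green2]). The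
    image vectors are diagonal in the given vectors up to a multiple of a fixed
    vector, and the interface conditions turn the contribution of that multiple
    into exactly the terms that cancel these forms ([dom_symmetric]).

    The domain of the adjoint is not larger. Testing against functions that
    vanish to second order at both ends of one side shows that the function
    component of an element of that domain is a weak, hence a regular, solution
    of the differential equation on each side ([weak_regular]). Green's formula
    then leaves an identity between boundary values and vectors, valid for
    arbitrary boundary data of the test function ([dom_data]), which yields the
    boundary conditions, the interface conditions and the image vectors one by
    one ([adjoint_pair_dom]).

    Density. Functions vanishing to second order at both ends are dense in
    [L^2] ([sq_approximable]): smooth functions of this kind approximate
    indicators of rays, and the closure is then enlarged to measurable sets,
    simple functions and all of [L^2] by dominated convergence. Adding such
    functions to one element of the domain with the prescribed vectors gives the
    density of the domain ([dom_dense]). *)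

(** * Integrals over compact intervals *)

Section Integrals.
Context {R : realType}.
Local Notation mu := (@lebesgue_measure R).
Implicit Types (f g : R -> R) (l r x : R).

Definition summable_on l r f := mu.-integrable `[l, r] (EFin \o f).

Definition int_on l r f : R := (\int[mu]_(x in `[l, r]) f x)%R.

Lemma mu_itv_lty l r : (mu `[l, r]%classic < +oo)%E.
Proof. by rewrite lebesgue_measure_itv /=; case: ifP => _; rewrite ?ltry // -EFinB ltry. Qed.

Lemma summable_measurable l r f :
  summable_on l r f -> measurable_fun `[l, r] f.
Proof. by move=> /integrableP[/measurable_EFinP]. Qed.

Lemma summable_onD l r f g : summable_on l r f -> summable_on l r g ->
  summable_on l r (fun x => f x + g x).
Proof.
move=> hf hg; have := @integrableD _ _ _ mu `[l, r]%classic (measurable_itv _) _ _ hf hg.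
by apply: eq_integrable => // x _.
Qed.

Lemma summable_onZ l r k f : summable_on l r f -> summable_on l r (fun x => k * f x).
Proof.
move=> hf; have := @integrableZl _ _ _ mu `[l, r]%classic (measurable_itv _) k _ hf.
by apply: eq_integrable => // x _.
Qed.

Lemma summable_onB l r f g : summable_on l r f -> summable_on l r g ->
  summable_on l r (fun x => f x - g x).
Proof.
move=> hf hg; have := @integrableB _ _ _ mu `[l, r]%classic (measurable_itv _) _ _ hf hg.
by apply: eq_integrable => // x _.
Qed.

Lemma summable_eq l r f g : {in `[l, r], f =1 g} -> summable_on l r f -> summable_on l r g.
Proof.
move=> fg; apply: eq_integrable => // x /set_mem xlr; rewrite /= fg //.
Qed.

Lemma summable_le l r f g : measurable_fun `[l, r] f ->
  (forall x, l <= x <= r -> `|f x| <= `|g x|) -> summable_on l r g -> summable_on l r f.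
Proof.
move=> mf fg; apply: le_integrable => //; exact/measurable_EFinP.
Qed.

Lemma summable_bounded l r f K : measurable_fun `[l, r] f ->
  (forall x, l <= x <= r -> `|f x| <= K) -> summable_on l r f.
Proof.
move=> mf fK; apply: measurable_bounded_integrable => //.
  exact: mu_itv_lty.
exists K; split; first exact: num_real.
move=> M KM x; rewrite /= in_itv /= => /fK /le_trans; apply; exact: ltW.
Qed.

Lemma summable_cst l r k : summable_on l r (fun=> k).
Proof. by apply: (@summable_bounded _ _ _ `|k|) => //; exact: measurable_cst. Qed.

Lemma summable_sub l r s t f : l <= s -> t <= r -> summable_on l r f -> summable_on s t f.
Proof.
move=> ls tr; apply: integrableS => //.
by apply: subset_itv; rewrite bnd_simp.
Qed.

Lemma summable_mulB l r f g K : summable_on l r f -> measurable_fun `[l, r] g ->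
  (forall x, l <= x <= r -> `|g x| <= K) -> summable_on l r (fun x => f x * g x).
Proof.
move=> hf mg gK.
have hK := summable_onZ K hf.
apply: summable_le hK; first exact: measurable_funM (summable_measurable hf) mg.
move=> x xlr; rewrite !normrM mulrC ler_wpM2r //.
exact: le_trans (gK _ xlr) (ler_norm _).
Qed.

Lemma int_onD l r f g : summable_on l r f -> summable_on l r g ->
  int_on l r (fun x => f x + g x) = int_on l r f + int_on l r g.
Proof. by move=> hf hg; exact: RintegralD. Qed.

Lemma int_onB l r f g : summable_on l r f -> summable_on l r g ->
  int_on l r (fun x => f x - g x) = int_on l r f - int_on l r g.
Proof. by move=> hf hg; exact: RintegralB. Qed.

Lemma int_onZ l r k f : summable_on l r f ->
  int_on l r (fun x => k * f x) = k * int_on l r f.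
Proof. by move=> hf; exact: RintegralZl. Qed.

Lemma eq_int_on l r f g : {in `[l, r], f =1 g} -> int_on l r f = int_on l r g.
Proof. by move=> fg; apply: eq_Rintegral => x /set_mem /fg. Qed.

Lemma int_on_cst l r k : l <= r -> int_on l r (fun=> k) = k * (r - l).
Proof.
move=> lr; rewrite /int_on Rintegral_cst //=. rewrite lebesgue_measure_itv /= lte_fin.
by move: lr; rewrite le_eqVlt => /predU1P[->|->]; rewrite ?ltxx ?subrr.
Qed.

Lemma int_on_id l f : int_on l l f = 0.
Proof. by rewrite /int_on set_itv1 Rintegral_set1. Qed.

Lemma int_on_split l m r f : l <= m -> m <= r -> summable_on l r f ->
  int_on l r f = int_on l m f + int_on m r f.
Proof.
move=> lm mr hf.
have h := @Rintegral_itvB R f (BLeft l) (BRight r) m hf.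
move: h; rewrite !bnd_simp => /(_ lm mr) h.
rewrite /int_on -[X in _ = _ + X]Rintegral_itv_obnd_cbnd -?h; first by rewrite addrC subrK.
apply: integrableS hf => //; apply: subset_itv; rewrite ?bnd_simp //.
Qed.

Lemma int_on_le l r f g : summable_on l r f -> summable_on l r g ->
  (forall x, l <= x <= r -> f x <= g x) -> int_on l r f <= int_on l r g.
Proof.
move=> hf hg fg; apply: le_Rintegral => // x; rewrite /= in_itv /=; exact: fg.
Qed.

Lemma int_on_ge0 l r f : (forall x, l <= x <= r -> 0 <= f x) -> 0 <= int_on l r f.
Proof. by move=> f0; apply: Rintegral_ge0 => x; rewrite /= in_itv /=; exact: f0. Qed.

Lemma le_int_on_norm l r f : summable_on l r f ->
  `|int_on l r f| <= int_on l r (fun x => `|f x|).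
Proof. by move=> hf; exact: le_normr_Rintegral. Qed.

Lemma summable_norm l r f : summable_on l r f -> summable_on l r (fun x => `|f x|).
Proof. by move=> hf; exact: integrable_norm. Qed.

Lemma prim_continuous l r f : l <= r -> summable_on l r f ->
  {within `[l, r], continuous (fun x => int_on l x f)}.
Proof. by move=> lr hf; exact: parameterized_integral_continuous. Qed.

Lemma prim_measurable l r f : l <= r -> summable_on l r f ->
  measurable_fun `[l, r] (fun x => int_on l x f).
Proof.
move=> lr hf; apply: subspace_continuous_measurable_fun => //.
exact: prim_continuous.
Qed.

Lemma prim_bounded l r f : summable_on l r f ->
  forall x, l <= x <= r -> `|int_on l x f| <= int_on l r (fun x => `|f x|).
Proof.
move=> hf x /andP[lx xr].
apply: le_trans (le_int_on_norm (summable_sub (lexx _) xr hf)) _.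
rewrite (int_on_split lx xr (summable_norm hf)) lerDl.
by apply: int_on_ge0 => *.
Qed.

Lemma summable_prim l r f : l <= r -> summable_on l r f ->
  summable_on l r (fun x => int_on l x f).
Proof.
move=> lr hf; apply: summable_bounded (prim_bounded hf).
exact: prim_measurable.
Qed.

Lemma int_on0 l r (f : R -> R) : (forall x, f x = 0) -> int_on l r f = 0.
Proof.
move=> f0; rewrite (eq_int_on (g := fun=> 0 * 1)) => [|x _]; last by rewrite f0 mul0r.
by rewrite int_onZ ?mul0r //; exact: summable_cst.
Qed.

End Integrals.

(** * Absolute continuity, integration by parts and square summability *)

Section IntegrationByParts.
Context {R : realType}.
Local Notation mu := (@lebesgue_measure R).
Implicit Types (f g : R -> R) (l r x : R).

Lemma int_on_fine l r f : summable_on l r f ->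
  (\int[mu]_(x in `[l, r]) (f x)%:E)%E = (int_on l r f)%:E.
Proof. by move=> hf; rewrite /int_on /Rintegral fineK //; exact: integrable_fin_num. Qed.

Lemma integrable_tensor (f g : R -> R) :
  mu.-integrable setT (EFin \o f) -> mu.-integrable setT (EFin \o g) ->
  (mu \x mu)%E.-integrable setT (fun p : R * R => (f p.1 * g p.2)%:E).
Proof.
move=> hf hg.
have mf : measurable_fun setT f by move/integrableP : hf => [/measurable_EFinP].
have mg : measurable_fun setT g by move/integrableP : hg => [/measurable_EFinP].
apply/integrable12ltyP.
  apply/measurable_EFinP; apply: measurable_funM.
    by apply: measurableT_comp.
  by apply: measurableT_comp.
under eq_integral => x _.
  under eq_integral => y _ do rewrite /= normrM EFinM.
  rewrite ge0_integralZl //; last first.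
    apply/measurable_EFinP; apply: measurableT_comp => //.
  over.
have /integrableP[_ hg'] := hg.
rewrite ge0_integralZr //; last first.
    by apply: integral_ge0.
  apply/measurable_EFinP; apply: measurableT_comp => //.
have /integrableP[_ hf'] := hf.
by rewrite lte_mul_pinfty // ?ge0_fin_numE // integral_ge0.
Qed.

Lemma integrable_patch l r f : summable_on l r f ->
  mu.-integrable setT (EFin \o f \_ `[l, r]).
Proof.
move=> hf; rewrite -restrict_EFin; apply: (@integrable_mkcond _ _ _ _ _ _ _).1 => //.
Qed.

Lemma integral_patch l r f : summable_on l r f ->
  (\int[mu]_x ((f \_ `[l, r]) x)%:E = (int_on l r f)%:E)%E.
Proof.
move=> hf; rewrite -int_on_fine // [in RHS]integral_mkcond.
by apply: eq_integral => x _; rewrite -[in RHS]/((EFin \o f) \_ _) restrict_EFin.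
Qed.

Lemma integral_patchZ k l r f : summable_on l r f ->
  (\int[mu]_x (k * (f \_ `[l, r]) x)%:E = (k * int_on l r f)%:E)%E.
Proof.
move=> hf; under eq_integral do rewrite EFinM.
rewrite integralZl //; last exact: integrable_patch.
by rewrite EFinM -integral_patch.
Qed.

Lemma summable_mul_prim l r f g : l <= r -> summable_on l r f -> summable_on l r g ->
  summable_on l r (fun x => f x * int_on l x g).
Proof.
move=> lr hf hg; apply: (summable_mulB hf (prim_measurable lr hg)).
exact: prim_bounded hg.
Qed.

(** The key to integration by parts: both terms are iterated integrals of
    [f x * g t], one over the triangle [t <= x] and the other, by Fubini, over
    its complement in the square. *)
Lemma int_prim_swap l r f g : l <= r -> summable_on l r f -> summable_on l r g ->
  int_on l r (fun x => f x * int_on l x g) + int_on l r (fun x => g x * int_on l x f)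
  = int_on l r f * int_on l r g.
Proof.
move=> lr hf hg.
pose D := `[l, r]%classic : set R.
have hf' := integrable_patch hf.
have hg' := integrable_patch hg.
pose T : set (R * R) := [set p | p.2 <= p.1].
have mT : measurable T.
  have mm : measurable_fun setT (fun p : R * R => p.1 - p.2).
    by apply: measurable_funB.
  have := mm measurableT `[0, +oo[%classic (measurable_itv _).
  rewrite setTI; congr measurable; apply/seteqP.
  by split => p; rewrite /T /= in_itv /= andbT subr_ge0.
pose F : R * R -> \bar R := fun p => ((f \_ D) p.1 * (g \_ D) p.2 * \1_T p)%:E.
have hF : (mu \x mu)%E.-integrable setT F.
  have mF0 := integrable_tensor hf' hg'.
  apply: le_integrable mF0 => //.
    apply/measurable_EFinP; apply: measurable_funM; last exact: measurable_indic.
    by have /integrableP[/measurable_EFinP] := integrable_tensor hf' hg'.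
  move=> p _; rewrite /F /= lee_fin normrM ler_piMr // indicE.
  by case: (_ \in _); rewrite ?normr1 ?normr0.
have memI (s t z : R) : (z \in `[s, t]%classic) = (s <= z <= t).
  by apply/idP/idP; rewrite inE /= in_itv.
have indT x y : \1_T (x, y) = (y <= x)%R%:R :> R.
  by rewrite indicE; congr (nat_of_bool _)%:R; apply/idP/idP; rewrite inE.
have E1 x : (\int[mu]_y F (x, y) = (((fun x => f x * int_on l x g) \_ D) x)%:E)%E.
  rewrite /F /= !patchE; case: ifPn => [|_]; last first.
    by rewrite integral0_eq // => y _; rewrite !mul0r.
  rewrite memI => /andP[lx xr].
  rewrite -integral_patchZ; last exact: summable_sub hg.
  apply: eq_integral => y _; rewrite -mulrA; congr (_ * _)%:E.
  rewrite !patchE indT !memI.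
  by case: (l <= y) => //=; case: (leP y x) => yx; rewrite ?mulr1 ?mulr0 ?mul0r ?if_same // (le_trans yx xr).
have E2 y : (\int[mu]_x F (x, y) = (((fun y => g y * int_on y r f) \_ D) y)%:E)%E.
  have gDy : (g \_ D) y = if y \in D then g y else 0 by rewrite patchE.
  rewrite patchE; under eq_integral do rewrite /F /= gDy.
  case: ifPn => [|_]; last first.
    by rewrite integral0_eq // => x _; rewrite mulr0 !mul0r.
  rewrite memI => /andP[ly yr].
  rewrite -integral_patchZ; last exact: summable_sub hf.
  apply: eq_integral => x _; rewrite mulrAC mulrC; congr (_ * _)%:E.
  rewrite !patchE indT !memI.
  by case: (leP y x) => yx; rewrite ?mulr1 ?mulr0 // (le_trans ly yx).
have := Fubini hF.
under eq_integral => x _ do rewrite E1.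
under [in RHS]eq_integral => x _ do rewrite E2.
have hfg := summable_mul_prim lr hf hg.
have hgf := summable_mul_prim lr hg hf.
have split_f y : y \in `[l, r] -> g y * int_on y r f = int_on l r f * g y - g y * int_on l y f.
  rewrite in_itv /= => /andP[ly yr].
  by rewrite (int_on_split ly yr hf); ring.
have hgf' : summable_on l r (fun y => g y * int_on y r f).
  apply: (@summable_eq _ _ _ (fun y => int_on l r f * g y - g y * int_on l y f)).
    by move=> y /split_f.
  by apply: summable_onB => //; exact: summable_onZ.
rewrite (integral_patch hfg) (integral_patch hgf') => -[->].
rewrite (eq_int_on split_f) int_onB ?int_onZ //; last exact: summable_onZ.
by rewrite subrK.
Qed.

(** Absolute continuity, in integral form: [f'] matters only up to a null set,
    and the boundary values of [f] are its values at [l] and [r]. *)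
Definition abscont l r f f' :=
  summable_on l r f' /\ forall x, l <= x <= r -> f x = f l + int_on l x f'.

Lemma abscont_bounded l r f f' : abscont l r f f' ->
  forall x, l <= x <= r -> `|f x| <= `|f l| + int_on l r (fun x => `|f' x|).
Proof.
move=> [hf' hf] x xlr; rewrite hf //; apply: le_trans (ler_normD _ _) _.
by rewrite lerD2l; apply: prim_bounded.
Qed.

Lemma abscont_measurable l r f f' : l <= r -> abscont l r f f' -> measurable_fun `[l, r] f.
Proof.
move=> lr [hf' hf]; apply: (@eq_measurable_fun _ _ _ _ _ (fun x => f l + int_on l x f')).
  by move=> x; rewrite inE /= in_itv /= => /hf.
by apply: measurable_funD => //; exact: prim_measurable.
Qed.

Lemma abscont_prim l r f' c : l <= r -> summable_on l r f' -> abscont l r (fun x => c + int_on l x f') f'.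
Proof. by move=> lr hf; split=> // x _; rewrite int_on_id addr0. Qed.

Lemma abscont_by_parts l r f f' g g' : l <= r -> abscont l r f f' -> abscont l r g g' ->
  int_on l r (fun x => f' x * g x) + int_on l r (fun x => f x * g' x) =
  f r * g r - f l * g l.
Proof.
move=> lr [hf Ef] [hg Eg].
have hfg := summable_mul_prim lr hf hg.
have hgf := summable_mul_prim lr hg hf.
rewrite (@eq_int_on _ _ _ _ (fun x => g l * f' x + f' x * int_on l x g')); last first.
  by move=> x; rewrite in_itv /= => /Eg ->; ring.
rewrite (@eq_int_on _ _ _ (fun x => f x * g' x) (fun x => f l * g' x + g' x * int_on l x f')); last first.
  by move=> x; rewrite in_itv /= => /Ef ->; ring.
rewrite !int_onD ?int_onZ //; try exact: summable_onZ.
rewrite addrACA int_prim_swap // (Ef r) ?(Eg r) ?lexx ?lr //; ring.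
Qed.

Lemma abscontD l r f f' g g' : abscont l r f f' -> abscont l r g g' ->
  abscont l r (fun x => f x + g x) (fun x => f' x + g' x).
Proof.
move=> [hf Ef] [hg Eg]; split; first exact: summable_onD.
move=> x /andP[lx xr]; rewrite (Ef x) ?(Eg x) ?lx //.
by rewrite int_onD; [ring|exact: summable_sub hf|exact: summable_sub hg].
Qed.

Lemma abscontZ l r k f f' : abscont l r f f' -> abscont l r (fun x => k * f x) (fun x => k * f' x).
Proof.
move=> [hf Ef]; split; first exact: summable_onZ.
move=> x /andP[lx xr]; rewrite (Ef x) ?lx //.
by rewrite int_onZ; [ring|exact: summable_sub hf].
Qed.

Lemma abscont_cst l r k : abscont l r (fun=> k) (fun=> 0).
Proof.
split=> [|x /andP[lx _]]; first exact: summable_cst.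
by rewrite int_on_cst // mul0r addr0.
Qed.

Definition sqsummable_on l r f := measurable_fun `[l, r] f /\ summable_on l r (fun x => f x ^+ 2).

Lemma sq_mul l r f g : sqsummable_on l r f -> sqsummable_on l r g -> summable_on l r (fun x => f x * g x).
Proof.
move=> [mf hf] [mg hg]; apply: summable_le (summable_onD hf hg); first exact: measurable_funM.
move=> x _; rewrite [leRHS]ger0_norm ?addr_ge0 ?sqr_ge0 // normrM -(real_normK (num_real (f x))) -(real_normK (num_real (g x))).
have := sqr_ge0 (`|f x| - `|g x|); have := normr_ge0 (f x); have := normr_ge0 (g x); nra.
Qed.

Lemma sq_bounded l r f K : measurable_fun `[l, r] f ->
  (forall x, l <= x <= r -> `|f x| <= K) -> sqsummable_on l r f.
Proof.
move=> mf fK; split=> //; apply: (@summable_bounded _ _ _ _ (K ^+ 2)).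
  exact: measurable_funX.
by move=> x /fK fxK; rewrite normrX ler_pXn2r // nnegrE // (le_trans _ fxK).
Qed.

Lemma sq_cst l r k : sqsummable_on l r (fun=> k).
Proof. by apply: (@sq_bounded _ _ _ `|k|). Qed.

Lemma sq_summable l r f : sqsummable_on l r f -> summable_on l r f.
Proof.
move=> hf; have := sq_mul hf (sq_cst l r 1).
by apply: summable_eq => x _; rewrite mulr1.
Qed.

Lemma sqD l r f g : sqsummable_on l r f -> sqsummable_on l r g -> sqsummable_on l r (fun x => f x + g x).
Proof.
move=> hf hg; split; first by apply: measurable_funD; [exact: hf.1 | exact: hg.1].
apply: (@summable_eq _ _ _ (fun x => (f x ^+ 2 + g x ^+ 2) + 2 * (f x * g x))).
  by move=> x _; ring.
apply: summable_onD; last exact/summable_onZ/sq_mul.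
by apply: summable_onD; [exact: hf.2 | exact: hg.2].
Qed.

Lemma sqZ l r k f : sqsummable_on l r f -> sqsummable_on l r (fun x => k * f x).
Proof.
move=> hf; split; first by apply: measurable_funM => //; exact: hf.1.
apply: (@summable_eq _ _ _ (fun x => k ^+ 2 * f x ^+ 2)); first by move=> x _; ring.
exact: summable_onZ hf.2.
Qed.

Lemma sqB l r f g : sqsummable_on l r f -> sqsummable_on l r g -> sqsummable_on l r (fun x => f x - g x).
Proof.
move=> hf /(sqZ (-1)) hg; have := sqD hf hg.
by congr sqsummable_on; apply/funext => x; rewrite mulN1r.
Qed.

Lemma sq_mulB l r f g K : sqsummable_on l r f -> measurable_fun `[l, r] g ->
  (forall x, l <= x <= r -> `|g x| <= K) -> sqsummable_on l r (fun x => f x * g x).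
Proof.
move=> [mf hf] mg gK; split; first exact: measurable_funM.
apply: (@summable_eq _ _ _ (fun x => f x ^+ 2 * g x ^+ 2)).
  by move=> x _; rewrite exprMn.
apply: (@summable_mulB _ _ _ _ _ (K ^+ 2)) => //; first exact: measurable_funX.
by move=> x /gK gxK; rewrite normrX ler_pXn2r // nnegrE // (le_trans _ gxK).
Qed.

Lemma abscont_sq l r f f' : l <= r -> abscont l r f f' -> sqsummable_on l r f.
Proof.
move=> lr hf; apply: sq_bounded (abscont_bounded hf); exact: abscont_measurable lr hf.
Qed.

Lemma sq_mul_abscont l r f g g' : l <= r -> sqsummable_on l r f -> abscont l r g g' -> sqsummable_on l r (fun x => f x * g x).
Proof.
by move=> lr hf hg; apply: sq_mulB hf (abscont_measurable lr hg) (abscont_bounded hg).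
Qed.

Lemma sq_sub l r s t (f : R -> R) : l <= s -> t <= r -> sqsummable_on l r f -> sqsummable_on s t f.
Proof.
move=> ls tr [mf hf]; split; last exact: summable_sub hf.
by apply: measurable_funS mf => //; apply: subset_itv; rewrite bnd_simp.
Qed.

(** The half-open interval on the right avoids counting the common endpoint
    [k] twice. *)
Lemma sq_join l k r (f : R -> R) : l <= k -> k <= r -> sqsummable_on l k f -> sqsummable_on k r f -> sqsummable_on l r f.
Proof.
move=> lk kr [mf1 hf1] [mf2 hf2].
have E : `[l, r]%classic = `[l, k]%classic `|` `]k, r]%classic.
  apply/seteqP; split => x /=; rewrite !in_itv /=.
    by move=> /andP[lx xr]; case: (leP x k) => xk; [left; rewrite lx|right; rewrite xr].
  by move=> [] /andP[h1 h2]; [rewrite h1 (le_trans h2)|rewrite h2 andbT (le_trans lk) ?ltW].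
have mf2' : measurable_fun `]k, r] f by rewrite measurable_fun_itv_obnd_cbndP.
have mf : measurable_fun `[l, r] f by rewrite E measurable_funU.
split=> //; apply/integrableP; split; first exact/measurable_EFinP/measurable_funX.
pose F : R -> \bar R := EFin \o (fun x => f x ^+ 2).
have mabs (A : set R) : measurable_fun A f -> measurable_fun A (fun x => `|F x|%E).
  by move=> mA; apply: measurableT_comp => //; apply/measurable_EFinP/measurable_funX.
have disj : [disjoint `[l, k]%classic & `]k, r]%classic].
  rewrite disj_set2E; apply/eqP/seteqP; split => x //=; rewrite !in_itv /= => -[/andP[_ xk] /andP[kx _]].
  by rewrite ltNge xk in kx.
rewrite E ge0_integral_setU //; last by rewrite -E; exact: mabs.
rewrite [X in (_ + X)%E]integral_itv_obnd_cbnd; last exact: mabs.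
by case/integrableP : hf1 => _ h1; case/integrableP : hf2 => _ h2; rewrite lte_add_pinfty.
Qed.

End IntegrationByParts.

(** * Almost everywhere equality and second order Sobolev functions *)

#[local] Instance ae_lebesgue_filter (R : realType) :
  Filter (almost_everywhere (@lebesgue_measure R)).
Proof. exact: ae_filter_ringOfSetsType. Qed.

Section RegularFunctions.
Context {R : realType}.
Local Notation mu := (@lebesgue_measure R).
Implicit Types (f g : R -> R) (l r x : R).

Definition aeq l r f g := {ae mu, forall x : R, x \in `]l, r[ -> f x = g x}.

Lemma ae_neq (c : R) : {ae mu, forall x : R, x <> c}.
Proof.
exists [set c]; split; [exact: measurable_set1|exact: lebesgue_measure_set1|].
by move=> x /= /contrapT.
Qed.

Lemma aeq_closed l r f g : aeq l r f g ->
  {ae mu, forall x : R, l <= x <= r -> f x = g x}.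
Proof.
rewrite /aeq; move: (ae_neq l) (ae_neq r); apply: filterS3 => x xl xr fg /andP[lx xr']; apply: fg.
rewrite in_itv /= !lt_neqAle lx xr' !andbT; apply/andP; split; apply/eqP => //.
exact: nesym.
Qed.

Lemma aeq_refl l r f : aeq l r f f.
Proof. by rewrite /aeq; apply: aeW => x. Qed.

Lemma aeq_in l r f g : (forall x, l < x < r -> f x = g x) -> aeq l r f g.
Proof. by rewrite /aeq => fg; apply: aeW => x; rewrite in_itv /=; exact: fg. Qed.

Lemma aeq_sym l r f g : aeq l r f g -> aeq l r g f.
Proof. by rewrite /aeq; apply: filterS => x fg /fg. Qed.

Lemma aeq_trans l r f g h : aeq l r f g -> aeq l r g h -> aeq l r f h.
Proof. by rewrite /aeq; apply: filterS2 => x fg gh xlr; rewrite fg ?gh. Qed.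

Lemma aeq2 (op : R -> R -> R) l r f g f' g' : aeq l r f f' -> aeq l r g g' ->
  aeq l r (fun x => op (f x) (g x)) (fun x => op (f' x) (g' x)).
Proof. by rewrite /aeq; apply: filterS2 => x ff' gg' xlr; rewrite ff' ?gg'. Qed.

Lemma aeq_sub l r s t (f g : R -> R) : l <= s -> t <= r -> aeq l r f g -> aeq s t f g.
Proof.
move=> ls tr; rewrite /aeq; apply: filterS => x fg; rewrite in_itv /= => /andP[sx xt].
by apply: fg; rewrite in_itv /= (le_lt_trans ls sx) (lt_le_trans xt tr).
Qed.

Lemma aeq_int l r f g : aeq l r f g -> measurable_fun `[l, r] f ->
  measurable_fun `[l, r] g -> int_on l r f = int_on l r g.
Proof.
move=> /aeq_closed fg mf mg; rewrite /int_on /Rintegral; congr fine.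
apply: ae_eq_integral => //; try exact/measurable_EFinP.
by move: fg; apply: filterS => x fg; rewrite /= in_itv /= => /fg ->.
Qed.

Lemma aeq_summable l r f g : aeq l r f g -> measurable_fun `[l, r] g ->
  summable_on l r f -> summable_on l r g.
Proof.
move=> /aeq_closed fg mg /integrableP[mf intf]; apply/integrableP; split.
  exact/measurable_EFinP.
rewrite (le_lt_trans _ intf) // le_eqVlt; apply/predU1P; left.
apply: ae_eq_integral => //; try exact: measurableT_comp.
  by do 2 apply: measurableT_comp => //.
by move: fg; apply: filterS => x fg; rewrite /= in_itv /= => /fg ->.
Qed.

Lemma aeq_sq l r f g : aeq l r f g -> measurable_fun `[l, r] g -> sqsummable_on l r f -> sqsummable_on l r g.
Proof.
move=> fg mg [mf hf]; split=> //; apply: aeq_summable hf; last exact: measurable_funX.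
exact: (aeq2 (fun a _ => a ^+ 2) fg fg).
Qed.

Lemma sq_int_eq0 l r f : sqsummable_on l r f -> int_on l r (fun x => f x ^+ 2) = 0 ->
  aeq l r f (fun=> 0).
Proof.
move=> [mf hf] h0.
have mf2 : measurable_fun `[l, r] (EFin \o (fun x => f x ^+ 2)).
  by move/integrableP : hf => [].
have : (\int[mu]_(x in `[l, r]) `|(f x ^+ 2)%R%:E| = 0)%E.
  transitivity (\int[mu]_(x in `[l, r]) (f x ^+ 2)%:E)%E.
    by apply: eq_integral => x _ /=; rewrite ger0_norm // sqr_ge0.
  by rewrite int_on_fine // h0.
rewrite /aeq; move/(ae_eq_integral_abs mu (measurable_itv _) mf2); apply: filterS => x /= + xlr.
have xlr' : x \in `[l, r] by move: xlr; rewrite !in_itv /= => /andP[/ltW -> /ltW ->].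
by move/(_ xlr') => -[/eqP]; rewrite sqrf_eq0 => /eqP.
Qed.

(** Extension by zero outside ]l, r[ and restriction to [[l, r]] have the same
    square integral, since endpoints are negligible. *)
Lemma L2onP l r f : L2on l r f <-> sqsummable_on l r f.
Proof.
have restr2 : (fun x => (f \_ `]l, r[) x ^+ 2) = (fun x => f x ^+ 2) \_ `]l, r[.
  by apply/funext => x; rewrite !patchE; case: ifP => // _; rewrite expr0n.
have mD : measurable_fun `[l, r] f <-> measurable_fun setT (f \_ `]l, r[).
  rewrite -measurable_fun_itv_bndo_bndcP -measurable_fun_itv_obnd_cbndP.
  by rewrite -(measurable_restrictT _ (measurable_itv _)).
have iD (h : R -> R) : measurable_fun `[l, r] h ->
    mu.-integrable setT (EFin \o h \_ `]l, r[) <-> summable_on l r h.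
  move=> mh; rewrite -restrict_EFin -integrable_mkcond //.
  have moo : measurable_fun `]l, r[ h.
    by apply: measurable_funS mh => //; exact: subset_itv_oo_cc.
  split => /integrableP[_ fi]; apply/integrableP; split; try exact/measurable_EFinP.
  - by rewrite integral_itv_bndoo //; do 2 apply: measurableT_comp => //.
  - by rewrite -(@integral_itv_bndoo _ _ _ _ true false) //; do 2 apply: measurableT_comp => //.
split.
- move=> hf; move: (hf); rewrite /L2on inE => /andP[]; rewrite inE /= => mf _.
  have mf' := mD.2 mf.
  split=> //; apply/iD; first exact: measurable_funX.
  by rewrite -restr2; exact: Lfun2_integrable_sqr hf.
- move=> [mf hf]; rewrite /L2on inE; apply/andP; split; rewrite inE /=.
    exact: mD.1.
  rewrite /finite_norm unlock /Lnorm poweR_lty //=.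
  have /integrableP[_] := (iD _ (measurable_funX 2 mf)).2 hf.
  apply: le_lt_trans; rewrite le_eqVlt; apply/predU1P; left.
  apply: eq_integral => x _ /=; rewrite powR_mulrn // -restr2.
  by rewrite /= normrX.
Qed.


Lemma abscont_aeq l r f f' g' : aeq l r f' g' -> measurable_fun `[l, r] g' ->
  abscont l r f f' -> abscont l r f g'.
Proof.
move=> fg mg [hf' hf]; split; first exact: aeq_summable hf'.
move=> x /andP[lx xr]; rewrite (hf x) ?lx //; congr (_ + _).
have sub : `[l, x]%classic `<=` `[l, r]%classic by apply: subset_itvl; rewrite bnd_simp.
apply: aeq_int; last exact: measurable_funS mg.
  move: fg; rewrite /aeq; apply: filterS => z fg; rewrite in_itv /= => /andP[lz zx].
  by apply: fg; rewrite in_itv /= lz (lt_le_trans zx).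
by apply: measurable_funS (summable_measurable hf').
Qed.

Lemma eq_oo_measurable l r f g : (forall x, l < x < r -> f x = g x) ->
  measurable_fun `[l, r] f -> measurable_fun `[l, r] g.
Proof.
move=> fg; rewrite -!measurable_fun_itv_bndo_bndcP -!measurable_fun_itv_obnd_cbndP.
by apply: eq_measurable_fun => x; rewrite inE /= in_itv /=; exact: fg.
Qed.

(** The derivative of a locally absolutely continuous function being summable
    on the whole interval, the function extends continuously to the closure. *)
Lemma ac_deriv_abscont l r f f' : l < r -> summable_on l r f' -> ac_deriv l r f f' ->
  exists2 F, abscont l r F f' & forall x, l < x < r -> f x = F x.
Proof.
move=> lr hf' [_ hf].
pose m := (l + r) / 2; have [lm mr] : l < m /\ m < r by rewrite /m; split; lra.
exists (fun x => f m - int_on l m f' + int_on l x f'); first exact: abscont_prim (ltW lr) hf'.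
move=> x /andP[lx xr]; case: (leP m x) => mx.
  have := hf _ _ lm mx xr; rewrite -/(int_on m x f') => h.
  rewrite (@int_on_split _ l m x f') ?(ltW lm) //; last exact: summable_sub (ltW xr) hf'.
  by rewrite -h; ring.
have := hf _ _ lx (ltW mx) mr; rewrite -/(int_on x m f') => h.
rewrite (@int_on_split _ l x m f') ?(ltW lx) ?(ltW mx) //; last exact: summable_sub (ltW mr) hf'.
by rewrite -h; ring.
Qed.

Lemma abscont_ac_deriv l r f f' F : abscont l r F f' -> (forall x, l < x < r -> f x = F x) ->
  ac_deriv l r f f'.
Proof.
move=> [hf' hF] fF; split.
  apply: open_integrable_locally; first exact: interval_open.
  by apply: integrableS hf' => //; exact: subset_itv_oo_cc.
move=> s t ls st tr; rewrite -/(int_on s t f').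
rewrite !fF ?ls ?(lt_le_trans ls st) ?(le_lt_trans st tr) ?tr //.
rewrite (hF s) ?(hF t) ?(ltW ls) ?(ltW (le_lt_trans st tr)) ?(ltW tr) ?(ltW (lt_le_trans ls st)) //.
rewrite (@int_on_split _ l s t f') ?(ltW ls) //; last exact: summable_sub (ltW tr) hf'.
by ring.
Qed.

Lemma abscont_continuous l r f f' : l <= r -> abscont l r f f' -> {within `[l, r], continuous f}.
Proof.
move=> lr [hf' hf].
apply: (@subspace_eq_continuous _ _ _ (fun x => f l + int_on l x f')).
  by move=> x; rewrite inE /= in_itv /= => /hf /esym.
move=> x; apply: cvgD; first exact: cvg_cst.
exact: prim_continuous lr hf' x.
Qed.

Lemma abscont_cvg_right l r f f' F : l < r -> abscont l r F f' -> (forall x, l < x < r -> f x = F x) ->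
  f x @[x --> l^'+] --> F l.
Proof.
move=> lr hF fF; have [_ + _] := (continuous_within_itvP F lr).1 (abscont_continuous (ltW lr) hF).
apply: cvg_trans; apply: near_eq_cvg; near=> x; rewrite fF //.
apply/andP; split; near: x; [exact: nbhs_right_gt|exact: nbhs_right_lt].
Unshelve. all: by end_near. Qed.

Lemma abscont_cvg_left l r f f' F : l < r -> abscont l r F f' -> (forall x, l < x < r -> f x = F x) ->
  f x @[x --> r^'-] --> F r.
Proof.
move=> lr hF fF; have [_ _] := (continuous_within_itvP F lr).1 (abscont_continuous (ltW lr) hF).
apply: cvg_trans; apply: near_eq_cvg; near=> x; rewrite fF //.
apply/andP; split; near: x; [exact: nbhs_left_gt|exact: nbhs_left_lt].
Unshelve. all: by end_near. Qed.

(** The fundamental theorem of calculus, for continuous derivatives. *)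
Lemma abscont_C1 l r f f' : l < r -> (forall x : R, is_derive x 1 f (f' x)) ->
  continuous f' -> abscont l r f f'.
Proof.
move=> lr df cf'.
have cf : continuous f by move=> x; apply: differentiable_continuous; apply/derivable1_diffP; case: (df x).
have hf' : summable_on l r f'.
  by apply: continuous_compact_integrable; [exact: segment_compact|exact: continuous_subspaceT].
split=> // x /andP[]; rewrite le_eqVlt => /predU1P[<- _|lx xr].
  by rewrite int_on_id addr0.
have : (\int[mu]_(t in `[l, x]) (f' t)%:E = (f x)%:E - (f l)%:E)%E.
  apply: continuous_FTC2 => //; first exact: continuous_subspaceT.
    split; first by move=> z _; case: (df z).
      by apply: cvg_at_right_filter; exact: cf.
    by apply: cvg_at_left_filter; exact: cf.
  by move=> z _; rewrite derive1E; case: (df z).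
rewrite int_on_fine; last exact: summable_sub xr hf'.
by rewrite -EFinB => -[->]; ring.
Qed.

(** The Sobolev space [H^2(l, r)], in terms of the representatives that are
    continuous up to the boundary. *)
Definition reg l r (y y' y'' : R -> R) := [/\ abscont l r y y', abscont l r y' y'' & sqsummable_on l r y''].

(** Having a summable derivative, [y] is bounded, so [q y] and hence [y''] are
    square summable; so [y] and [y'] extend continuously to the closed interval. *)
Lemma ac_deriv_reg l r q y y' y'' : l < r -> sqsummable_on l r q ->
  ac_deriv l r y y' -> ac_deriv l r y' y'' -> L2on l r y' ->
  L2on l r (fun x => - y'' x + q x * y x) ->
  exists Y Y', [/\ reg l r Y Y' y'', (forall x, l < x < r -> y x = Y x) &
                   (forall x, l < x < r -> y' x = Y' x)].
Proof.
move=> lr hq hy hy' /L2onP sy' /L2onP sl.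
have [Y hY yY] := ac_deriv_abscont lr (sq_summable sy') hy.
have sqY : sqsummable_on l r (fun x => q x * Y x) by apply: sq_mul_abscont (ltW lr) hq hY.
have my'' : measurable_fun `[l, r] y''.
  have [[my'' _ _] _] := hy'.
  by apply/measurable_fun_itv_bndo_bndcP/measurable_fun_itv_obnd_cbndP.
have sy'' : sqsummable_on l r y''.
  apply: (aeq_sq _ _ (sqB sqY sl)) => //.
  by apply: aeq_in => x xlr; rewrite yY //; ring.
have [Y' hY' yY'] := ac_deriv_abscont lr (sq_summable sy'') hy'.
exists Y, Y'; split=> //; split=> //.
by apply: abscont_aeq hY; [exact: aeq_in|exact: abscont_measurable (ltW lr) hY'].
Qed.

Lemma reg_ext l r (y y' y'' z'' : R -> R) : (forall x, l < x < r -> y'' x = z'' x) ->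
  reg l r y y' y'' -> reg l r y y' z''.
Proof.
move=> yz [hy hy' sy]; have mz := eq_oo_measurable yz sy.1.
by split=> //; [exact: abscont_aeq (aeq_in yz) mz hy'|exact: aeq_sq (aeq_in yz) mz sy].
Qed.

Lemma reg_ac_deriv l r q y y' y'' Y Y' : l < r -> sqsummable_on l r q -> reg l r Y Y' y'' ->
  (forall x, l < x < r -> y x = Y x) -> (forall x, l < x < r -> y' x = Y' x) ->
  [/\ ac_deriv l r y y', ac_deriv l r y' y'', L2on l r y, L2on l r y' &
      L2on l r (fun x => - y'' x + q x * y x)].
Proof.
move=> lr hq [hY hY' sy''] yY yY'.
have Yy' x : l < x < r -> Y' x = y' x by move/yY'.
have Yy x : l < x < r -> Y x = y x by move/yY.
have mY' := abscont_measurable (ltW lr) hY'; have mY := abscont_measurable (ltW lr) hY.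
split.
- apply: abscont_ac_deriv yY; apply: abscont_aeq hY; first exact: aeq_in.
  exact: eq_oo_measurable mY'.
- exact: abscont_ac_deriv yY'.
- apply/L2onP/(aeq_sq (aeq_in Yy)); first exact: eq_oo_measurable mY.
  exact: abscont_sq (ltW lr) hY.
- apply/L2onP/(aeq_sq (aeq_in Yy')); first exact: eq_oo_measurable mY'.
  exact: abscont_sq (ltW lr) hY'.
- have sh : sqsummable_on l r (fun x => q x * Y x - y'' x) by apply: sqB => //; exact: sq_mul_abscont (ltW lr) hq hY.
  have hh x : l < x < r -> q x * Y x - y'' x = - y'' x + q x * y x.
    by move=> xlr; rewrite yY //; ring.
  by apply/L2onP/(aeq_sq (aeq_in hh)) => //; apply: eq_oo_measurable hh _; case: sh.
Qed.

End RegularFunctions.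

(** * Green's formula, interpolation and weak solutions *)

Section WeakSolutions.
Context {R : realType}.
Local Notation mu := (@lebesgue_measure R).
Implicit Types (f g q : R -> R) (l r x : R).

(** Integration by parts twice: the two occurrences of the integral of [y' z']
    cancel, and so do the terms in [q]. *)
Lemma green l r q y y' y'' z z' z'' : l <= r -> sqsummable_on l r q ->
  reg l r y y' y'' -> reg l r z z' z'' ->
  int_on l r (fun x => (- y'' x + q x * y x) * z x) -
  int_on l r (fun x => y x * (- z'' x + q x * z x)) =
  (y r * z' r - y' r * z r) - (y l * z' l - y' l * z l).
Proof.
move=> lr hq [hy hy' sy''] [hz hz' sz''].
have sy := abscont_sq lr hy; have sz := abscont_sq lr hz.
have sqy := sq_mul_abscont lr hq hy; have sqz := sq_mul_abscont lr hq hz.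
have ly : sqsummable_on l r (fun x => - y'' x + q x * y x).
  have := sqB sqy sy''; congr sqsummable_on; apply/funext => x; ring.
have lz : sqsummable_on l r (fun x => - z'' x + q x * z x).
  have := sqB sqz sz''; congr sqsummable_on; apply/funext => x; ring.
rewrite -int_onB; [|exact: sq_mul..].
transitivity (int_on l r (fun x => z'' x * y x) - int_on l r (fun x => y'' x * z x)).
  rewrite -int_onB; [|exact: sq_mul..].
  by apply: eq_int_on => x _; ring.
have e1 := abscont_by_parts lr hy' hz; have e2 := abscont_by_parts lr hz' hy.
have e3 : int_on l r (fun x => z' x * y' x) = int_on l r (fun x => y' x * z' x).
  by apply: eq_int_on => x _; ring.
rewrite e3 in e2.
lra.
Qed.

Lemma abscont_shift l r m : l < r -> abscont l r (fun x => x - m) (fun=> 1).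
Proof.
move=> lr; apply: abscont_C1 => //.
  move=> x; apply: is_derive_eq; rewrite oppr0 addr0 //.
by move=> x; exact: cvg_cst.
Qed.

Lemma abscont_shift2 l r m : l < r -> abscont l r (fun x => (x - m) ^+ 2 / 2) (fun x => x - m).
Proof.
move=> lr; apply: abscont_C1 => //.
  by move=> x; apply: is_derive_eq; rewrite /GRing.scale /=; field.
by move=> x; apply: cvgB; [exact: cvg_id|exact: cvg_cst].
Qed.

Lemma abscont_shift3 l r m : l < r -> abscont l r (fun x => (x - m) ^+ 3 / 3) (fun x => (x - m) ^+ 2).
Proof.
move=> lr; apply: abscont_C1 => //.
  by move=> x; apply: is_derive_eq; rewrite /GRing.scale /=; field.
by move=> x; apply: cvgM; apply: cvgB; (exact: cvg_id||exact: cvg_cst).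
Qed.

(** Hermite interpolation by a cubic polynomial in [x - l]. *)
Lemma hermite l r (A A' B B' : R) : l < r ->
  exists y y' y'', [/\ reg l r y y' y'', y l = A, y' l = A', y r = B & y' r = B'].
Proof.
move=> lr.
pose L := r - l; have L0 : L != 0 by rewrite subr_eq0 gt_eqF.
(* the coefficients are solved for from the data at [r] *)
pose c2 := (3 * (B - A) / L - 2 * A' - B') / L.
pose c3 := (2 * (A - B) / L + A' + B') / L ^+ 2.
exists (fun x => A + (A' * (x - l) + (2 * c2 * ((x - l) ^+ 2 / 2) + 3 * c3 * ((x - l) ^+ 3 / 3)))).
exists (fun x => A' + (2 * c2 * (x - l) + 6 * c3 * ((x - l) ^+ 2 / 2))).
exists (fun x => 2 * c2 + 6 * c3 * (x - l)).
have cst := abscont_cst l r.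
split.
- have a1 := abscont_shift l lr; have a2 := abscont_shift2 l lr; have a3 := abscont_shift3 l lr.
  split.
  + have := abscontD (cst A) (abscontD (abscontZ A' a1) (abscontD (abscontZ (2 * c2) a2) (abscontZ (3 * c3) a3))).
    by congr abscont; apply/funext => x; field.
  + have := abscontD (cst A') (abscontD (abscontZ (2 * c2) a1) (abscontZ (6 * c3) a2)).
    by congr abscont; apply/funext => x; field.
  + by apply: sqD; [exact: sq_cst|apply: sqZ; exact: abscont_sq (ltW lr) a1].
- by rewrite subrr; ring.
- by rewrite subrr; ring.
- by rewrite -/L /c2 /c3; field.
- by rewrite -/L /c2 /c3; field.
Qed.

(** A du Bois-Reymond argument. If [g2] is a second primitive of
    [g0 = q z - w], two integrations by parts turn the hypothesis into the orthogonality of [p = z - g2] to every square summable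
    [h] that is the second derivative of a function vanishing to second order at
    both ends, that is, to every [h] orthogonal to the affine functions. Taking
    for [h] the component of [p] orthogonal to the affine functions gives
    [h = 0], so that [z] is almost everywhere [g2] plus an affine function. *)
Lemma weak_regular l r q z w : l < r -> sqsummable_on l r q -> sqsummable_on l r z -> sqsummable_on l r w ->
  (forall y y' y'', reg l r y y' y'' -> y l = 0 -> y' l = 0 -> y r = 0 -> y' r = 0 ->
    int_on l r (fun x => (- y'' x + q x * y x) * z x) =
    int_on l r (fun x => y x * w x)) ->
  exists Z Z', reg l r Z Z' (fun x => q x * Z x - w x) /\ aeq l r z Z.
Proof.
move=> lr hq hz hw hyp.
have lr' := ltW lr.
pose g0 x := q x * z x - w x.
have hg0 : summable_on l r g0 by exact: summable_onB (sq_mul hq hz) (sq_summable hw).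
pose g1 x := int_on l x g0.
have a1 : abscont l r g1 g0 by have := abscont_prim 0 lr' hg0; congr abscont; apply/funext => x; rewrite add0r.
pose g2 x := int_on l x g1.
have a2 : abscont l r g2 g1.
  by have := abscont_prim 0 lr' (summable_prim lr' hg0); congr abscont; apply/funext => x; rewrite add0r.
pose p x := z x - g2 x.
have sp : sqsummable_on l r p by exact: sqB hz (abscont_sq lr' a2).
(* [1] and [e] are an orthogonal basis of the affine functions *)
pose m := (l + r) / 2; pose e x := x - m.
have ae1 : abscont l r e (fun=> 1) := abscont_shift m lr.
have se : sqsummable_on l r e := abscont_sq lr' ae1.
have ie : int_on l r e = 0.
  have [_ /(_ r)] := abscont_shift2 m lr; rewrite lr' lexx => /(_ isT) h.
  have : (r - m) ^+ 2 / 2 - (l - m) ^+ 2 / 2 = 0 by rewrite /m; field.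
  rewrite h addrAC subrr add0r; exact.
pose E2 := int_on l r (fun x => e x * e x).
have E20 : E2 != 0.
  have [_ /(_ r)] := abscont_shift3 m lr; rewrite lr' lexx => /(_ isT) h.
  have -> : E2 = (r - m) ^+ 3 / 3 - (l - m) ^+ 3 / 3.
    by rewrite h addrAC subrr add0r; apply: eq_int_on => x _; rewrite expr2.
  have -> : (r - m) ^+ 3 / 3 - (l - m) ^+ 3 / 3 = (r - l) ^+ 3 / 12 by rewrite /m; field.
  by rewrite gt_eqF // divr_gt0 // exprn_gt0 // subr_gt0.
pose ca := int_on l r p / (r - l); pose cb := int_on l r (fun x => p x * e x) / E2.
pose h x := p x - (ca + cb * e x).
have sl : sqsummable_on l r (fun x => ca + cb * e x) by apply: sqD; [exact: sq_cst|exact: sqZ].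
have sh : sqsummable_on l r h by exact: sqB sp sl.
have rl0 : r - l != 0 by rewrite subr_eq0 gt_eqF.
have ih : int_on l r h = 0.
  rewrite (int_onB (sq_summable sp) (sq_summable sl)).
  rewrite (int_onD (summable_cst l r ca) (sq_summable (sqZ cb se))).
  rewrite int_on_cst // (int_onZ _ (sq_summable se)).
  by rewrite ie mulr0 addr0 /ca divfK // subrr.
have ihe : int_on l r (fun x => h x * e x) = 0.
  rewrite (@eq_int_on _ _ _ _ (fun x => p x * e x - (ca * e x + cb * (e x * e x)))); last first.
    by move=> x _; rewrite /h; ring.
  have see := sq_mul se se.
  have s1 := summable_onZ ca (sq_summable se); have s2 := summable_onZ cb see.
  rewrite (int_onB (sq_mul sp se) (summable_onD s1 s2)) (int_onD s1 s2).
  rewrite (int_onZ _ (sq_summable se)) (int_onZ _ see).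
  by rewrite ie mulr0 add0r /cb divfK // subrr.
(* the test function is the second primitive of [h] vanishing at [l]; its data
   at [r] vanish because [h] is orthogonal to [1] and [e] *)
pose y' x := int_on l x h.
have ay' : abscont l r y' h.
  by have := abscont_prim 0 lr' (sq_summable sh); congr abscont; apply/funext => x; rewrite add0r.
pose y x := int_on l x y'.
have ay : abscont l r y y'.
  have := abscont_prim 0 lr' (summable_prim lr' (sq_summable sh)).
  by congr abscont; apply/funext => x; rewrite add0r.
have y'l : y' l = 0 by exact: int_on_id.
have yl : y l = 0 by exact: int_on_id.
have y'r : y' r = 0 by exact: ih.
have yr : y r = 0.
  have := abscont_by_parts lr' ay' ae1; rewrite ihe add0r y'l y'r !mul0r subrr => <-.
  by apply: eq_int_on => x _; rewrite mulr1.
have sy : sqsummable_on l r y := abscont_sq lr' ay.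
have weak := hyp _ _ _ (And3 ay ay' sh) yl y'l yr y'r.
have shz := sq_mul sh hz.
have ihz : int_on l r (fun x => y x * g0 x) = int_on l r (fun x => h x * z x).
  have sqy := sq_mul_abscont lr' hq ay.
  have sly : sqsummable_on l r (fun x => - h x + q x * y x).
    by have := sqB sqy sh; congr sqsummable_on; apply/funext => x; rewrite addrC.
  rewrite (@eq_int_on _ _ _ _ (fun x => ((- h x + q x * y x) * z x + h x * z x) - y x * w x)); last first.
    by move=> x _; rewrite /g0; ring.
  rewrite (int_onB (summable_onD (sq_mul sly hz) shz) (sq_mul sy hw)).
  by rewrite (int_onD (sq_mul sly hz) shz) weak; ring.
have ihg2 : int_on l r (fun x => h x * g2 x) = int_on l r (fun x => y x * g0 x).
  have h1 := abscont_by_parts lr' ay a1; rewrite yl yr !mul0r subrr in h1.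
  have h2 := abscont_by_parts lr' ay' a2; rewrite y'l y'r !mul0r subrr in h2.
  by move: h1 h2; move: (int_on _ _ _) (int_on _ _ _) (int_on _ _ _) => A B C; lra.
have ihh : int_on l r (fun x => h x ^+ 2) = 0.
  rewrite (@eq_int_on _ _ _ _ (fun x => (h x * z x - h x * g2 x) - (ca * h x + cb * (h x * e x)))); last first.
    by move=> x _; rewrite [in LHS]expr2 {2}/h /p; ring.
  have shg := sq_mul sh (abscont_sq lr' a2); have she := sq_mul sh se.
  have s1 := summable_onZ ca (sq_summable sh); have s2 := summable_onZ cb she.
  rewrite (int_onB (summable_onB shz shg) (summable_onD s1 s2)).
  rewrite (int_onB shz shg) (int_onD s1 s2) (int_onZ _ (sq_summable sh)) (int_onZ _ she).
  by rewrite ih ihe ihg2 ihz; ring.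
have h0 := sq_int_eq0 sh ihh.
(* the regular representative of [z] *)
pose Z x := g2 x + (ca + cb * e x); pose Z' x := g1 x + (0 + cb * 1).
have cst := abscont_cst l r.
have aZ : abscont l r Z Z' := abscontD a2 (abscontD (cst ca) (abscontZ cb ae1)).
have aZ' : abscont l r Z' g0.
  have := abscontD a1 (cst (0 + cb * 1)); congr abscont; apply/funext => x.
  by rewrite addr0.
have zZ : aeq l r z Z.
  move: h0; rewrite /aeq; apply: filterS => x + xlr => /(_ xlr).
  by rewrite /h /p /Z => hx; lra.
have sZ'' : sqsummable_on l r (fun x => q x * Z x - w x) by apply: sqB => //; exact: sq_mul_abscont aZ.
exists Z, Z'; split=> //; split=> //.
apply: (abscont_aeq _ (sZ''.1) aZ').
by apply: (aeq2 (fun a b => a - b) _ (aeq_refl _ _ _)); apply: (aeq2 *%R (aeq_refl _ _ _)).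
Qed.

End WeakSolutions.

(** * Density of the functions vanishing to second order at the ends *)

Section Density.
Context {R : realType}.
Local Notation mu := (@lebesgue_measure R).
Implicit Types (f g q : R -> R) (l r x : R).

(** The Sobolev space [H^2_0(l, r)]. *)
Definition H20 l r (y : R -> R) := exists y' y'',
  [/\ reg l r y y' y'', y l = 0, y' l = 0, y r = 0 & y' r = 0].

(** Membership in the [L^2]-closure of [H^2_0(l, r)]. *)
Definition approximable l r f :=
  forall e : R, 0 < e -> exists2 y, H20 l r y & int_on l r (fun x => (f x - y x) ^+ 2) < e.

Lemma H20_sq l r y : l <= r -> H20 l r y -> sqsummable_on l r y.
Proof. by move=> lr [y' [y'' [[hy _ _] _ _ _ _]]]; exact: abscont_sq hy. Qed.

Lemma H20D l r y z : H20 l r y -> H20 l r z -> H20 l r (fun x => y x + z x).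
Proof.
move=> [y' [y'' [[hy hy' sy] yl y'l yr y'r]]] [z' [z'' [[hz hz' sz] zl z'l zr z'r]]].
exists (fun x => y' x + z' x), (fun x => y'' x + z'' x).
split; rewrite ?yl ?y'l ?yr ?y'r ?zl ?z'l ?zr ?z'r ?addr0 //.
by split; [exact: abscontD|exact: abscontD|exact: sqD].
Qed.

Lemma H20Z l r k y : H20 l r y -> H20 l r (fun x => k * y x).
Proof.
move=> [y' [y'' [[hy hy' sy] yl y'l yr y'r]]].
exists (fun x => k * y' x), (fun x => k * y'' x).
split; rewrite ?yl ?y'l ?yr ?y'r ?mulr0 //.
by split; [exact: abscontZ|exact: abscontZ|exact: sqZ].
Qed.

Lemma sq_intD_le l r f g : sqsummable_on l r f -> sqsummable_on l r g ->
  int_on l r (fun x => (f x + g x) ^+ 2) <=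
  2 * int_on l r (fun x => f x ^+ 2) + 2 * int_on l r (fun x => g x ^+ 2).
Proof.
move=> hf hg.
rewrite -(int_onZ _ hf.2) -(int_onZ _ hg.2) -(int_onD (summable_onZ 2 hf.2) (summable_onZ 2 hg.2)).
apply: int_on_le; [exact: (sqD hf hg).2|exact: summable_onD (summable_onZ 2 hf.2) (summable_onZ 2 hg.2)|].
by move=> x _; have := sqr_ge0 (f x - g x); nra.
Qed.

Lemma approximableD l r f g : l <= r -> sqsummable_on l r f -> sqsummable_on l r g ->
  approximable l r f -> approximable l r g -> approximable l r (fun x => f x + g x).
Proof.
move=> lr sf sg hf hg e e0.
have e40 : 0 < e / 4 by lra.
have [y Hy ye] := hf _ e40; have [z Hz ze] := hg _ e40.
exists (fun x => y x + z x); first exact: H20D.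
have := sq_intD_le (sqB sf (H20_sq lr Hy)) (sqB sg (H20_sq lr Hz)).
rewrite (@eq_int_on _ _ _ _ (fun x => (f x + g x - (y x + z x)) ^+ 2)) => [|x _]; last by ring.
move=> h; lra.
Qed.

Lemma approximableZ l r k f : l <= r -> sqsummable_on l r f ->
  approximable l r f -> approximable l r (fun x => k * f x).
Proof.
move=> lr sf hf e e0.
have k0 : 0 < k ^+ 2 + 1 by rewrite ltr_wpDl ?sqr_ge0.
have [y Hy ye] := hf _ (divr_gt0 e0 k0).
exists (fun x => k * y x); first exact: H20Z.
rewrite (@eq_int_on _ _ _ _ (fun x => k ^+ 2 * (f x - y x) ^+ 2)) => [|x _]; last by ring.
have sfy := sqB sf (H20_sq lr Hy).
rewrite (int_onZ _ sfy.2).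
have I0 : 0 <= int_on l r (fun x => (f x - y x) ^+ 2) by apply: int_on_ge0 => x _; exact: sqr_ge0.
rewrite ltr_pdivlMr // in ye.
apply: le_lt_trans ye; rewrite mulrC ler_wpM2l //; lra.
Qed.

Lemma approximable_ext l r f g : (forall x, l < x < r -> f x = g x) -> sqsummable_on l r f ->
  l <= r -> approximable l r f -> approximable l r g.
Proof.
move=> fg sf lr hf e /hf[y Hy ye]; exists y => //; apply: le_lt_trans ye.
have sg := eq_oo_measurable fg sf.1; have sy := (H20_sq lr Hy).1.
rewrite le_eqVlt; apply/predU1P; left; apply: aeq_int.
- by apply: aeq_in => x xlr; rewrite fg.
- by apply: measurable_funX; apply: measurable_funB.
- by apply: measurable_funX; apply: measurable_funB => //; case: sf.
Qed.

(** By dominated convergence, [f_ n] tends to [f] in [L^2]. *)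
Lemma approximable_lim l r f (f_ : nat -> R -> R) G : l <= r -> sqsummable_on l r f -> sqsummable_on l r G ->
  (forall n, sqsummable_on l r (f_ n)) -> (forall n, approximable l r (f_ n)) ->
  (forall n x, l <= x <= r -> `|f_ n x - f x| <= G x) ->
  {ae mu, forall x : R, x \in `]l, r[ -> f_ n x @[n --> \oo] --> f x} ->
  approximable l r f.
Proof.
move=> lr sf sG sf_ af_ fG flim.
pose d n x := (f_ n x - f x) ^+ 2.
have sd n : summable_on l r (d n) := (sqB (sf_ n) sf).2.
have md n : measurable_fun `[l, r] (EFin \o d n) by move/integrableP : (sd n) => [].
have dG : {ae mu, forall x n, `[l, r]%classic x -> (`|(d n x)%:E| <= (G x ^+ 2)%:E)%E}.
  apply: aeW => x n; rewrite /= in_itv /= => /fG fGx; rewrite lee_fin /d.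
  by rewrite ger0_norm ?sqr_ge0 // -real_normK ?num_real // ler_pXn2r // nnegrE (le_trans _ (fGx n)).
have d0 : {ae mu, forall x : R, `[l, r]%classic x -> (d n x)%:E @[n --> \oo] --> 0%E}.
  move: (ae_neq l) (ae_neq r) flim; apply: filterS3 => x xl xr h; rewrite /= in_itv /= => /andP[lx xr'].
  have xlr : x \in `]l, r[.
    by rewrite in_itv /= !lt_neqAle lx xr' !andbT; apply/andP; split; apply/eqP => //; exact: nesym.
  apply: cvg_EFin; first exact: nearW.
  have := h xlr => /cvgB /(_ (cvg_cst (f x))); rewrite subrr => hh.
  by have := cvgM hh hh; rewrite mulr0; exact.
have [_ _] := @dominated_convergence _ _ _ mu `[l, r]%classic (measurable_itv _)
  (fun n x => (d n x)%:E) (fun=> 0%E) (fun x => (G x ^+ 2)%:E) md (measurable_cst _) d0 sG.2 dG.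
rewrite integral0.
rewrite (_ : [sequence _]_n = (fun n => (int_on l r (d n))%:E)); last first.
  by apply/funext => n; rewrite /= int_on_fine.
move/fine_cvgP => [_] /cvgrPdist_lt hcvg.
move=> e e0; have e40 : 0 < e / 4 by lra.
have [N _ /(_ N (leqnn N))] := hcvg _ e40.
rewrite sub0r normrN /= => hN.
have [y Hy ye] := af_ N _ e40.
exists y => //.
have h1 := sq_intD_le (sqB sf (sf_ N)) (sqB (sf_ N) (H20_sq lr Hy)).
rewrite (@eq_int_on _ _ _ (fun x => (f x - f_ N x + (f_ N x - y x)) ^+ 2) (fun x => (f x - y x) ^+ 2)) in h1; last first.
  by move=> x _; congr (_ ^+ 2); ring.
rewrite (@eq_int_on _ _ _ (fun x => (f x - f_ N x) ^+ 2) (d N)) in h1; last first.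
  by move=> x _; rewrite /d; ring.
have h2 := ler_norm (int_on l r (d N)).
lra.
Qed.

Let w l r x := (x - l) * (r - x).
Let v l r c k x := w l r x ^+ 2 * expR (k * (x - c)).

(** The functions [v / (1 + v)] are smooth, vanish to second order at both ends
    because [w ^ 2] does, and tend to the indicator of [x > c] on ]l, r[ as [k]
    tends to infinity, because there [v] tends to infinity or to 0 according to
    the sign of [x - c]. *)
Lemma H20_bump l r c k : l < r -> H20 l r (fun x => 1 - (1 + v l r c k x)^-1).
Proof.
move=> lr.
pose w' x := r + l - 2 * x.
pose v' x := (2 * w l r x * w' x + k * w l r x ^+ 2) * expR (k * (x - c)).
pose v'' x := (2 * w' x ^+ 2 + 2 * w l r x * (- 2) + k * (2 * w l r x * w' x)
   + k * (2 * w l r x * w' x + k * w l r x ^+ 2)) * expR (k * (x - c)).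
have v1 x : 1 + v l r c k x != 0.
  by rewrite gt_eqF // ltr_wpDr // mulr_ge0 ?sqr_ge0 // expR_ge0.
have dw x : is_derive x 1 (w l r) (w' x).
  by apply: is_derive_eq; rewrite /w' /GRing.scale /=; ring.
have dv x : is_derive x 1 (v l r c k) (v' x).
  by apply: is_derive_eq; rewrite /v' /GRing.scale /=; ring.
have dv' x : is_derive x 1 v' (v'' x).
  by apply: is_derive_eq; rewrite /v'' /v' /w' /GRing.scale /=; ring.
have cont (f f' : R -> R) : (forall x, is_derive x 1 f (f' x)) -> continuous f.
  move=> df x; apply: differentiable_continuous; apply/derivable1_diffP.
  by case: (df x).
have cw := cont _ _ dw; have cv' := cont _ _ dv'.
have dv'' x : is_derive x 1 v'' ('D_1 v'' x).
  by apply: DeriveDef => //; apply: ex_derive.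
pose s x := (1 + v l r c k x)^-1.
have ds x : is_derive x 1 s (- (v' x * s x ^+ 2)).
  apply: is_derive_eq; first exact: is_deriveV.
  by rewrite /s /GRing.scale /=; field; exact: v1.
have cs := cont _ _ ds.
pose y' x := v' x * s x ^+ 2.
pose y'' x := v'' x * s x ^+ 2 - 2 * v' x ^+ 2 * s x ^+ 3.
have dy x : is_derive x 1 (fun x => 1 - s x) (y' x).
  by apply: is_derive_eq; rewrite /y'; ring.
have dy' x : is_derive x 1 y' (y'' x).
  by apply: is_derive_eq; rewrite /y'' /GRing.scale /=; ring.
have cy'' : continuous y''.
  move=> x; apply: differentiable_continuous; apply/derivable1_diffP.
  by apply: ex_derive.
have ay' := abscont_C1 lr dy' cy''.
have wl : w l r l = 0 by rewrite /w subrr mul0r.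
have wr : w l r r = 0 by rewrite /w subrr mulr0.
exists y', y''; split.
- split=> //; first by apply: abscont_C1 dy _ => //; exact: cont dy'.
  split; first by case: ay' => /summable_measurable.
  apply: continuous_compact_integrable; first exact: segment_compact.
  by apply: continuous_subspaceT => x; apply: cvgM; exact: cy''.
- by rewrite /v wl expr0n mul0r addr0 invr1 subrr.
- by rewrite /y' /v' wl expr0n !(mulr0, mul0r) addr0 !mul0r.
- by rewrite /v wr expr0n mul0r addr0 invr1 subrr.
- by rewrite /y' /v' wr expr0n !(mulr0, mul0r) addr0 !mul0r.
Qed.

Lemma sq_indic l r (A : set R) : measurable A -> sqsummable_on l r (\1_A : R -> R).
Proof.
move=> mA; apply: (@sq_bounded _ _ _ _ 1) => [|x _]; first exact: measurable_indic.
by rewrite indicE; case: (_ \in _); rewrite ?normr1 ?normr0.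
Qed.

Lemma approximable_H20 l r y : H20 l r y -> approximable l r y.
Proof.
move=> Hy e e0; exists y => //.
rewrite (@eq_int_on _ _ _ _ (fun=> 0 * 1)) => [|x _]; last by rewrite subrr expr0n mul0r.
by rewrite int_onZ ?mul0r //; exact: summable_cst.
Qed.

Lemma approximable_sum l r (g : nat -> R -> R) n : l < r ->
  (forall k, sqsummable_on l r (g k) /\ approximable l r (g k)) ->
  let s x := \sum_(k < n) g k x in sqsummable_on l r s /\ approximable l r s.
Proof.
move=> lr hg; elim: n => [|n [IH1 IH2]] /=.
  have H0 := H20Z 0 (H20_bump 0 0 lr).
  have -> : (fun x => \sum_(k < 0) g k x) = fun x => 0 * (1 - (1 + v l r 0 0 x)^-1).
    by apply/funext => x; rewrite big_ord0 mul0r.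
  by split; [exact: H20_sq (ltW lr) H0|exact: approximable_H20].
have -> : (fun x => \sum_(k < n.+1) g k x) = fun x => \sum_(k < n) g k x + g n x.
  by apply/funext => x; rewrite big_ord_recr.
have [h1 h2] := hg n.
by split; [exact: sqD|exact: approximableD (ltW lr) IH1 h1 IH2 h2].
Qed.

Lemma cvg_harmonic_bound (u : nat -> R) (a K : R) :
  (forall n, `|u n - a| <= K * n.+1%:R^-1) -> u n @[n --> \oo] --> a.
Proof.
move=> uK; have hn := cvgM (cvg_cst K) (@cvg_harmonic R).
apply: (@squeeze_cvgr _ _ _ _ (fun n => a - K * harmonic n) (fun n => a + K * harmonic n)).
- by apply: nearW => n; have := uK n; rewrite ler_distl /harmonic /=.
- by rewrite -[X in _ --> X]subr0 -(mulr0 K); apply: cvgB; [exact: cvg_cst|exact: hn].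
- by rewrite -[X in _ --> X]addr0 -(mulr0 K); apply: cvgD; [exact: cvg_cst|exact: hn].
Qed.

Lemma approximable_ray l r c : l < r -> approximable l r (\1_`]c, +oo[ : R -> R).
Proof.
move=> lr.
pose f_ n x : R := 1 - (1 + v l r c n.+1%:R x)^-1.
have v0 n x : 0 <= v l r c n.+1%:R x by rewrite mulr_ge0 ?sqr_ge0 ?expR_ge0.
have sf n : sqsummable_on l r (f_ n) by apply: H20_sq (H20_bump c _ lr); exact: ltW.
have si : sqsummable_on l r (\1_`]c, +oo[ : R -> R) by apply: sq_indic.
apply: (@approximable_lim l r _ f_ (fun=> 2)) => //; first exact: ltW.
- exact: sq_cst.
- by move=> n; apply/approximable_H20/H20_bump.
- move=> n x _; rewrite /f_.
  have iv : 0 <= (1 + v l r c n.+1%:R x)^-1 <= 1.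
    by rewrite invr_ge0 ?invf_le1 ?ltr_wpDr ?addr_ge0 ?lerDl ?v0.
  move: iv; move: (_^-1) => t /andP[t0 t1].
  by rewrite indicE; case: (_ \in _); rewrite ler_norml /=; apply/andP; split; lra.
move: (ae_neq c); apply: filterS => x xc; rewrite in_itv /= => /andP[lx xr].
have w0 : 0 < w l r x by rewrite mulr_gt0 // subr_gt0.
have w20 : 0 < w l r x ^+ 2 by rewrite exprn_gt0.
have expge n t : 0 < t -> n.+1%:R * t <= expR (n.+1%:R * t) :> R.
  by move=> t0; apply: le_trans (expR_ge1Dx _); rewrite lerDr.
have n0 n : 0 < n.+1%:R :> R by rewrite ltr0n.
have ray : \1_`]c, +oo[ x = (c < x)%R%:R :> R.
  by rewrite indicE; congr (nat_of_bool _)%:R; apply/idP/idP; rewrite inE /= in_itv /= andbT.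
case: (ltgtP c x) => [cx|xc'|cx]; last by case: xc.
- have d0 : 0 < x - c by rewrite subr_gt0.
  apply: (@cvg_harmonic_bound _ _ (w l r x ^+ 2 * (x - c))^-1) => n.
  rewrite ray /f_ cx addrAC subrr sub0r normrN.
  rewrite ger0_norm; last by rewrite invr_ge0 addr_ge0.
  have le1 : w l r x ^+ 2 * (x - c) * n.+1%:R <= 1 + v l r c n.+1%:R x.
    by rewrite ler_wpDl // /v -mulrA ler_wpM2l ?(ltW w20) // mulrC expge.
  rewrite -invfM lef_pV2 ?posrE //; first by rewrite ltr_wpDr.
  by apply: mulr_gt0 => //; exact: mulr_gt0.
- have d0 : 0 < c - x by rewrite subr_gt0.
  apply: (@cvg_harmonic_bound _ _ (w l r x ^+ 2 / (c - x))) => n.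
  rewrite ray /f_ (lt_gtF xc') subr0.
  have v10 : 0 < 1 + v l r c n.+1%:R x by rewrite ltr_wpDr.
  have -> : 1 - (1 + v l r c n.+1%:R x)^-1 = v l r c n.+1%:R x / (1 + v l r c n.+1%:R x).
    by field; rewrite gt_eqF.
  rewrite ger0_norm ?divr_ge0 ?(ltW v10) //.
  apply: (@le_trans _ _ (v l r c n.+1%:R x)).
    by rewrite ler_pdivrMr // ler_peMr // lerDl.
  rewrite /v -mulrA -invfM ler_wpM2l ?(ltW w20) //.
  have -> : n.+1%:R * (x - c) = - (n.+1%:R * (c - x)) by ring.
  rewrite expRN lef_pV2 ?posrE ?expR_gt0 //; first by rewrite mulrC expge.
  exact: mulr_gt0.
Qed.

(** Dynkin's pi-lambda theorem, from the rays. *)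
Lemma approximable_indic l r (A : set R) : l < r -> measurable A ->
  approximable l r (\1_A : R -> R).
Proof.
move=> lr mA.
have lr' := ltW lr.
have P1 : approximable l r (\1_[set: R] : R -> R).
  apply: approximable_ext (approximable_ray (l - 1) lr) => //; last exact: sq_indic.
  move=> x /andP[lx xr]; rewrite !indicE !mem_set //= in_itv /= andbT; lra.
have : (@RGenOInfty.G R).-sigma.-measurable A by rewrite -RGenOInfty.measurableE.
apply: (@dynkin_induction _ (measurableTypeR R) (@RGenOInfty.G R) (fun A => approximable l r (\1_A : R -> R))).
- exact: RGenOInfty.measurableE.
- move=> _ _ [x ->] [y ->]; exists (Num.max x y).
  by apply/seteqP; split => z /=; rewrite !in_itv /= !andbT gt_max => /andP.
- exact: P1.
- by move=> _ [x ->]; exact: approximable_ray.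
- move=> S mS PS.
  have := approximableD lr' (sq_indic l r measurableT) (sqZ (-1) (sq_indic l r mS)) P1
    (approximableZ (-1) lr' (sq_indic l r mS) PS).
  congr approximable; apply/funext => x; rewrite !indicE in_setT in_setC.
  by case: (x \in S); rewrite /= ?mulr0 ?addr0 // mulN1r subrr.
- move=> F mF tF PF.
  pose s n x : R := \sum_(k < n) \1_(F k) x.
  have sE k x : F k x -> forall n, s n x = (k < n)%N%:R.
    move=> Fkx n; have FE j : \1_(F j) x = (j == k)%:R :> R.
      rewrite indicE; congr (nat_of_bool _)%:R; apply/idP/eqP => [|->].
        by rewrite inE => Fjx; apply: tF => //; exists x.
      by rewrite inE.
    rewrite /s; elim: n => [|n IH]; first by rewrite big_ord0.
    rewrite big_ord_recr /= IH FE ltnS -natrD.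
    by case: (ltngtP k n).
  have s0 x : ~ (\bigcup_k F k) x -> forall n, s n x = 0.
    move=> nFx n; rewrite /s big1 // => k _; rewrite indicE memNset // => Fkx.
    by apply: nFx; exists k.
  have ss n : sqsummable_on l r (s n) /\ approximable l r (s n).
    apply: (@approximable_sum l r (fun k => \1_(F k))) => // k; split=> //; exact: (sq_indic l r (mF k)).
  apply: (@approximable_lim l r _ s (fun=> 1)) => //.
  - by apply: sq_indic; exact: bigcupT_measurable.
  - exact: sq_cst.
  - by move=> n; case: (ss n).
  - by move=> n; case: (ss n).
  - move=> n x _; rewrite indicE; case: (boolP (x \in _)); rewrite ?inE ?notin_setE => Fx.
      have [k _ Fkx] := Fx; rewrite (sE _ _ Fkx); case: ltnP => _ /=; first by rewrite subrr normr0.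
      by rewrite sub0r normrN1.
    by rewrite s0 // subrr normr0.
  - apply: aeW => x _; apply: cvg_near_cst; rewrite indicE.
    case: (boolP (x \in _)); rewrite ?inE ?notin_setE => Fx.
      have [k _ Fkx] := Fx; near=> n; rewrite (sE _ _ Fkx).
      suff -> : (k < n)%N by [].
      by near: n; exact: nbhs_infty_gt.
    by apply: nearW => n; rewrite s0.
Unshelve. all: by end_near. Qed.

Import HBNNSimple.

(** Simple functions increasing to [f] are dominated by [f]. *)
Lemma approximable_sq_ge0 l r f : l < r -> sqsummable_on l r f -> (forall x, 0 <= f x) ->
  approximable l r f.
Proof.
move=> lr sf f0; have lr' := ltW lr.
have mf : measurable_fun `[l, r] (EFin \o f) by apply/measurable_EFinP; case: sf.
have f0' x : `[l, r]%classic x -> (0 <= (EFin \o f) x)%E by move=> _; rewrite lee_fin.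
pose s n : R -> R := nnsfun_approx (measurable_itv `[l, r]) mf n.
have ss n : sqsummable_on l r (s n) /\ approximable l r (s n).
  pose V : seq R := finmap.enum_fset (fset_set (range (nnsfun_approx (measurable_itv `[l, r]) mf n))).
  pose B k := s n @^-1` [set V`_k].
  have mB k : measurable (B k) by exact: measurable_funPTI.
  have -> : s n = fun x => \sum_(k < size V) (V`_k * \1_(B k) x).
    by apply/funext => x; exact: fimfunEord.
  apply: (@approximable_sum l r (fun k x => V`_k * \1_(B k) x)) => // k.
  have sB := sq_indic l r (mB k).
  by split; [exact: sqZ|apply: approximableZ => //; exact: approximable_indic].
apply: (@approximable_lim l r _ s f) => //.
- by move=> n; case: (ss n).
- by move=> n; case: (ss n).
- move=> n x xlr; have xlr' : `[l, r]%classic x by rewrite /= in_itv.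
  have s0 : 0 <= s n x by exact: fun_ge0.
  have sle : s n x <= f x.
    have := le_approx n f0' xlr'; rewrite lee_fin; apply: le_trans.
    by rewrite /s nnsfun_approxE.
  rewrite ler_norml; apply/andP; split; lra.
- apply: aeW => x; rewrite in_itv /= => /andP[lx xr].
  have xlr' : `[l, r]%classic x by rewrite /= in_itv /= !ltW.
  have := cvg_nnsfun_approx (measurable_itv `[l, r]) mf f0' xlr'.
  by move/fine_cvgP => [].
Qed.

(** Density of [H^2_0(l, r)] in [L^2(l, r)]; [f] is half the difference of the
    nonnegative functions [`|f| + f] and [`|f| - f]. *)
Theorem sq_approximable l r f : l < r -> sqsummable_on l r f -> approximable l r f.
Proof.
move=> lr sf; have lr' := ltW lr.
have sn : sqsummable_on l r (fun x => `|f x|).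
  split; first by apply: measurableT_comp => //; case: sf.
  by have := sf.2; apply: summable_eq => x _; rewrite real_normK // num_real.
have sfn := sqD sn sf; have sfn' := sqD sn (sqZ (-1) sf).
have a1 : approximable l r (fun x => `|f x| + f x).
  by apply: approximable_sq_ge0 => // x; have := ler_norm (- f x); rewrite normrN; lra.
have a2 : approximable l r (fun x => `|f x| + -1 * f x).
  by apply: approximable_sq_ge0 => // x; rewrite mulN1r subr_ge0 ler_norm.
have := approximableD lr' (sqZ 2^-1 sfn) (sqZ (- 2^-1) sfn') (approximableZ _ lr' sfn a1)
  (approximableZ _ lr' sfn' a2).
by congr approximable; apply/funext => x; field.
Qed.

End Density.

(** * The real operator on the two sides of 0 *)

Record jet (R : realType) := Jet { jval : R -> R; jder : R -> R; jder2 : R -> R }.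

Lemma bc_wronskian (R : realType) (c s A A' Z Z' : R) : c ^+ 2 + s ^+ 2 = 1 ->
  A * c = A' * s -> Z * c = Z' * s -> A * Z' - A' * Z = 0.
Proof.
move=> cs hA hZ.
have h1 : (A * Z' - A' * Z) * c = 0.
  transitivity ((A * c) * Z' - A' * (Z * c)); [by ring|rewrite hA hZ; ring].
have h2 : (A * Z' - A' * Z) * s = 0.
  transitivity (A * (Z' * s) - (A' * s) * Z); [by ring|rewrite -hA -hZ; ring].
by rewrite -[LHS]mulr1 -cs !expr2 mulrDr !mulrA h1 h2 !mul0r addr0.
Qed.

Section RealOperator.
Context {R : realType}.
Local Notation mu := (@lebesgue_measure R).
Variables (a b : R) (ha : 0 < a) (hb : 0 < b) (q : R -> R).
Variables (hq1 : sqsummable_on (- a) 0 q) (hq2 : sqsummable_on 0 b q).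
Variables (ca sa cb sb : R) (hca : ca ^+ 2 + sa ^+ 2 = 1) (hcb : cb ^+ 2 + sb ^+ 2 = 1).
Variables (s1 s2 : bool) (th1 th2 : R) (n m : nat).
Variables (w1 D1 : 'I_n -> R) (w2 D2 : 'I_m -> R).
Implicit Types (Y Z : jet R) (u : 'I_n -> R) (v : 'I_m -> R).

Let na0 : - a < 0. Proof. by rewrite oppr_lt0. Qed.

Definition jreg l r Y := reg l r (jval Y) (jder Y) (jder2 Y).

Definition jell Y x := - jder2 Y x + q x * jval Y x.

(** [P1], [Q1], [P2], [Q2] rearrange the values [y(0+)], [y'(0-)] and the jumps
    of [y] and [y'] at 0 so that both cases of each interface condition take the
    same form: [P] is the coefficient of the vector in the image, and [Q] can be
    solved for. *)
Definition P1 Y1 Y2 := if s1 then jder Y2 0 - jder Y1 0 else jval Y2 0.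
Definition Q1 Y1 Y2 := if s1 then jval Y2 0 else jder Y2 0 - jder Y1 0.
Definition P2 Y1 Y2 := if s2 then jval Y2 0 - jval Y1 0 else jder Y1 0.
Definition Q2 Y1 Y2 := if s2 then jder Y1 0 else jval Y2 0 - jval Y1 0.
Definition sgn1 : R := if s1 then - 1 else 1.
Definition sgn2 : R := if s2 then 1 else - 1.

Definition rdot (k : nat) (x y : 'I_k -> R) := \sum_(i < k) x i * y i.

(** The domain of the operator restricted to real functions; [Y1] and [Y2] are
    the restrictions to the two sides of 0. *)
Record dom Y1 Y2 u v : Prop := Dom {
  dom_reg1 : jreg (- a) 0 Y1;
  dom_reg2 : jreg 0 b Y2;
  dom_bc1 : jval Y1 (- a) * ca = jder Y1 (- a) * sa;
  dom_bc2 : jval Y2 b * cb = jder Y2 b * sb;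
  dom_tr1 : sgn1 * Q1 Y1 Y2 + th1 * P1 Y1 Y2 = rdot u w1;
  dom_tr2 : sgn2 * Q2 Y1 Y2 + th2 * P2 Y1 Y2 = rdot v w2 }.

(** The two finite-dimensional components of the image. *)
Definition im1 Y1 Y2 u := fun i => P1 Y1 Y2 * w1 i + u i * D1 i.
Definition im2 Y1 Y2 v := fun i => P2 Y1 Y2 * w2 i + v i * D2 i.

Lemma rdotC k (x y : 'I_k -> R) : rdot x y = rdot y x.
Proof. by apply: eq_bigr => i _; rewrite mulrC. Qed.

Lemma rdot_rank1 k p (w D x y : 'I_k -> R) :
  rdot (fun i => p * w i + x i * D i) y = p * rdot y w + rdot x (fun i => y i * D i).
Proof.
rewrite /rdot mulr_sumr -big_split; apply: eq_bigr => i _ /=; ring.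
Qed.

Lemma rdot_sym k (D x y : 'I_k -> R) :
  rdot x (fun i => y i * D i) = rdot y (fun i => x i * D i).
Proof. by apply: eq_bigr => i _; ring. Qed.

(** The boundary terms at 0 are the sum of two symplectic forms, one for each
    interface condition. *)
Lemma green2 Y1 Y2 Z1 Z2 : jreg (- a) 0 Y1 -> jreg 0 b Y2 -> jreg (- a) 0 Z1 -> jreg 0 b Z2 ->
  (int_on (- a) 0 (fun x => jell Y1 x * jval Z1 x) + int_on 0 b (fun x => jell Y2 x * jval Z2 x)) -
  (int_on (- a) 0 (fun x => jval Y1 x * jell Z1 x) + int_on 0 b (fun x => jval Y2 x * jell Z2 x)) =
  (jval Y2 b * jder Z2 b - jder Y2 b * jval Z2 b)
  - (jval Y1 (- a) * jder Z1 (- a) - jder Y1 (- a) * jval Z1 (- a))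
  - sgn1 * (P1 Y1 Y2 * Q1 Z1 Z2 - P1 Z1 Z2 * Q1 Y1 Y2)
  - sgn2 * (P2 Y1 Y2 * Q2 Z1 Z2 - P2 Z1 Z2 * Q2 Y1 Y2).
Proof.
move=> rY1 rY2 rZ1 rZ2.
have g1 := green (ltW na0) hq1 rY1 rZ1; have g2 := green (ltW hb) hq2 rY2 rZ2.
rewrite opprD addrACA g1 g2 /sgn1 /sgn2 /P1 /Q1 /P2 /Q2.
by case: s1; case: s2; ring.
Qed.

(** The boundary conditions at [- a] and [b] kill the outer boundary terms, and
    each interface condition makes the rank one part of the finite-dimensional
    component produce minus the corresponding symplectic form. *)
Lemma dom_symmetric Y1 Y2 u v Z1 Z2 u' v' : dom Y1 Y2 u v -> dom Z1 Z2 u' v' ->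
  int_on (- a) 0 (fun x => jell Y1 x * jval Z1 x) + int_on 0 b (fun x => jell Y2 x * jval Z2 x)
    + rdot (im1 Y1 Y2 u) u' + rdot (im2 Y1 Y2 v) v' =
  int_on (- a) 0 (fun x => jval Y1 x * jell Z1 x) + int_on 0 b (fun x => jval Y2 x * jell Z2 x)
    + rdot u (im1 Z1 Z2 u') + rdot v (im2 Z1 Z2 v').
Proof.
move=> [rY1 rY2 bY1 bY2 tY1 tY2] [rZ1 rZ2 bZ1 bZ2 tZ1 tZ2].
have g := green2 rY1 rY2 rZ1 rZ2.
rewrite [rdot u _]rdotC [rdot v _]rdotC !rdot_rank1 -tY1 -tY2 -tZ1 -tZ2.
rewrite (rdot_sym D1 u' u) (rdot_sym D2 v' v).
have B1 : jval Y1 (- a) * jder Z1 (- a) - jder Y1 (- a) * jval Z1 (- a) = 0.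
  exact: bc_wronskian hca bY1 bZ1.
have B2 : jval Y2 b * jder Z2 b - jder Y2 b * jval Z2 b = 0.
  exact: bc_wronskian hcb bY2 bZ2.
rewrite B1 B2 in g.
move: g; set I1 := _ + int_on _ _ _; set I2 := _ + int_on _ _ _ => g.
have -> : I1 = I2 + (I1 - I2) by ring.
rewrite g; ring.
Qed.

(** The interface conditions determine [Q1] and [Q2] from [P1], [P2] and the
    vectors, which are therefore free; cubic interpolation does the rest. *)
Lemma dom_data (A A' B B' p1 p2 : R) u v : A * ca = A' * sa -> B * cb = B' * sb ->
  exists Y1 Y2, [/\ dom Y1 Y2 u v, P1 Y1 Y2 = p1, P2 Y1 Y2 = p2,
    [/\ jval Y1 (- a) = A & jder Y1 (- a) = A'] & [/\ jval Y2 b = B & jder Y2 b = B']].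
Proof.
move=> hA hB.
have sgn1K x : sgn1 * (sgn1 * x) = x by rewrite /sgn1; case: s1; ring.
have sgn2K x : sgn2 * (sgn2 * x) = x by rewrite /sgn2; case: s2; ring.
pose q1 := sgn1 * (rdot u w1 - th1 * p1); pose q2 := sgn2 * (rdot v w2 - th2 * p2).
pose yp := if s1 then q1 else p1; pose Dy' := if s1 then p1 else q1.
pose y'm := if s2 then q2 else p2; pose Dy := if s2 then p2 else q2.
have [y1 [y1' [y1'' [r1 y1a y1'a y10 y1'0]]]] := hermite A A' (yp - Dy) y'm na0.
have [y2 [y2' [y2'' [r2 y20 y2'0 y2b y2'b]]]] := hermite yp (y'm + Dy') B B' hb.
exists (Jet y1 y1' y1''), (Jet y2 y2' y2'').
have hP1 : P1 (Jet y1 y1' y1'') (Jet y2 y2' y2'') = p1.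
  by rewrite /P1 /= y2'0 y20 y1'0 /yp /Dy'; case: s1 => //; ring.
have hP2 : P2 (Jet y1 y1' y1'') (Jet y2 y2' y2'') = p2.
  by rewrite /P2 /= y20 y10 y1'0 /y'm /Dy; case: s2 => //; ring.
split=> //; split=> //=; rewrite ?y1a ?y1'a ?y2b ?y2'b //.
- rewrite hP1 (_ : Q1 _ _ = q1); first by rewrite /q1 sgn1K; ring.
  by rewrite /Q1 /= y2'0 y20 y1'0 /yp /Dy'; case: s1 => //; ring.
- rewrite hP2 (_ : Q2 _ _ = q2); first by rewrite /q2 sgn2K; ring.
  by rewrite /Q2 /= y20 y10 y1'0 /y'm /Dy; case: s2 => //; ring.
Qed.


(** The pair of [(f, u, v)] and [(g, s, t)] is in the graph of the adjoint of
    the real operator. *)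
Definition adjoint_pair f g u v s t := forall Y1 Y2 u' v', dom Y1 Y2 u' v' ->
  int_on (- a) 0 (fun x => jell Y1 x * f x) + int_on 0 b (fun x => jell Y2 x * f x)
    + rdot (im1 Y1 Y2 u') u + rdot (im2 Y1 Y2 v') v =
  int_on (- a) 0 (fun x => jval Y1 x * g x) + int_on 0 b (fun x => jval Y2 x * g x)
    + rdot u' s + rdot v' t.

Definition zero_jet : jet R := Jet (fun=> 0) (fun=> 0) (fun=> 0).

Lemma zero_jet_reg l r : jreg l r zero_jet.
Proof.
have cst := abscont_cst l r (0 : R).
by split=> //; exact: sq_cst.
Qed.

Lemma rdot0 k (y : 'I_k -> R) : rdot (fun=> 0) y = 0.
Proof. by rewrite /rdot big1 // => i _; rewrite mul0r. Qed.

Lemma dom_zero : dom zero_jet zero_jet (fun=> 0) (fun=> 0).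
Proof.
split; rewrite ?mul0r ?rdot0 //; try exact: zero_jet_reg.
- by rewrite /P1 /Q1 /= subrr; case: s1; ring.
- by rewrite /P2 /Q2 /= subrr; case: s2; ring.
Qed.

(** Testing against functions supported on one side of 0 shows that an element
    of the domain of the adjoint is regular on each side. *)
Lemma adjoint_pair_regular f g u v s t : sqsummable_on (- a) 0 f -> sqsummable_on 0 b f -> sqsummable_on (- a) 0 g -> sqsummable_on 0 b g ->
  adjoint_pair f g u v s t ->
  exists Z1 Z2, [/\ jreg (- a) 0 Z1, jreg 0 b Z2, aeq (- a) 0 f (jval Z1), aeq 0 b f (jval Z2) &
    (forall x, jell Z1 x = g x) /\ (forall x, jell Z2 x = g x)].
Proof.
move=> sf1 sf2 sg1 sg2 adj.
have [z1 [z1' [rz1 fz1]]] : exists Z Z' : R -> R, reg (- a) 0 Z Z' (fun x => q x * Z x - g x) /\ aeq (- a) 0 f Z.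
  apply: weak_regular => // y y' y'' ry yl y'l yr y'r.
  have : dom (Jet y y' y'') zero_jet (fun=> 0) (fun=> 0).
    split=> //=; rewrite ?yl ?y'l ?mul0r //; first exact: zero_jet_reg.
    - by rewrite rdot0 /P1 /Q1 /= y'r; case: s1; ring.
    - by rewrite rdot0 /P2 /Q2 /= yr y'r; case: s2; ring.
  move/adj; rewrite !rdot0 !addr0 /= [int_on 0 b _]int_on0; last by move=> x; rewrite /jell /=; ring.
  rewrite [int_on 0 b _]int_on0; last by move=> x; rewrite mul0r.
  rewrite !addr0.
  have P10 : P1 (Jet y y' y'') zero_jet = 0 by rewrite /P1 /= y'r; case: s1; ring.
  have P20 : P2 (Jet y y' y'') zero_jet = 0 by rewrite /P2 /= yr y'r; case: s2; ring.
  rewrite !rdot_rank1 P10 P20 !mul0r !rdot0 !addr0; exact.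
have [z2 [z2' [rz2 fz2]]] : exists Z Z' : R -> R, reg 0 b Z Z' (fun x => q x * Z x - g x) /\ aeq 0 b f Z.
  apply: weak_regular => // y y' y'' ry yl y'l yr y'r.
  have : dom zero_jet (Jet y y' y'') (fun=> 0) (fun=> 0).
    split=> //=; rewrite ?yr ?y'r ?mul0r //; first exact: zero_jet_reg.
    - by rewrite rdot0 /P1 /Q1 /= y'l yl; case: s1; ring.
    - by rewrite rdot0 /P2 /Q2 /= yl; case: s2; ring.
  move/adj; rewrite !rdot0 !addr0 /= [int_on (- a) 0 _]int_on0; last by move=> x; rewrite /jell /=; ring.
  rewrite [int_on (- a) 0 _]int_on0; last by move=> x; rewrite mul0r.
  rewrite !add0r.
  have P10 : P1 zero_jet (Jet y y' y'') = 0 by rewrite /P1 /= y'l yl; case: s1; ring.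
  have P20 : P2 zero_jet (Jet y y' y'') = 0 by rewrite /P2 /= yl; case: s2; ring.
  rewrite !rdot_rank1 P10 P20 !mul0r !rdot0 !addr0; exact.
exists (Jet z1 z1' (fun x => q x * z1 x - g x)), (Jet z2 z2' (fun x => q x * z2 x - g x)).
by split=> //; split=> x; rewrite /jell /=; ring.
Qed.

(** Once [f] is known to be regular, Green's formula leaves only boundary terms
    and finite-dimensional terms. They vanish for all boundary data, which can be
    varied one at a time. *)
Lemma adjoint_pair_dom f g u v s t : sqsummable_on (- a) 0 f -> sqsummable_on 0 b f -> sqsummable_on (- a) 0 g -> sqsummable_on 0 b g ->
  adjoint_pair f g u v s t ->
  exists Z1 Z2, [/\ dom Z1 Z2 u v, aeq (- a) 0 f (jval Z1), aeq 0 b f (jval Z2),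
    (forall x, jell Z1 x = g x) /\ (forall x, jell Z2 x = g x) &
    s = im1 Z1 Z2 u /\ t = im2 Z1 Z2 v].
Proof.
move=> sf1 sf2 sg1 sg2 adj.
have [Z1 [Z2 [rZ1 rZ2 fZ1 fZ2 [lZ1 lZ2]]]] := adjoint_pair_regular sf1 sf2 sg1 sg2 adj.
have sq_jell l r Y : l < r -> sqsummable_on l r q -> jreg l r Y -> sqsummable_on l r (jell Y).
  move=> lr hq [hy _ sy]; have := sqB (sq_mul_abscont (ltW lr) hq hy) sy.
  by congr sqsummable_on; apply/funext => x; rewrite /jell addrC.
have bdry Y1 Y2 u' v' : dom Y1 Y2 u' v' ->
  (jval Y2 b * jder Z2 b - jder Y2 b * jval Z2 b)
  - (jval Y1 (- a) * jder Z1 (- a) - jder Y1 (- a) * jval Z1 (- a))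
  - sgn1 * (P1 Y1 Y2 * Q1 Z1 Z2 - P1 Z1 Z2 * Q1 Y1 Y2)
  - sgn2 * (P2 Y1 Y2 * Q2 Z1 Z2 - P2 Z1 Z2 * Q2 Y1 Y2)
  + rdot (im1 Y1 Y2 u') u + rdot (im2 Y1 Y2 v') v = rdot u' s + rdot v' t.
  move=> dY; have := adj _ _ _ _ dY; have [rY1 rY2 _ _ _ _] := dY.
  have aux l r Y Z : l < r -> sqsummable_on l r q -> sqsummable_on l r f -> sqsummable_on l r g -> jreg l r Y -> jreg l r Z ->
      aeq l r f (jval Z) -> (forall x, jell Z x = g x) ->
      int_on l r (fun x => jell Y x * f x) = int_on l r (fun x => jell Y x * jval Z x) /\
      int_on l r (fun x => jval Y x * g x) = int_on l r (fun x => jval Y x * jell Z x).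
    move=> lr hq sf sg rY rZ fZ lZ; have [mlY _] := sq_jell _ _ _ lr hq rY.
    have [hZ _ _] := rZ; have mZ := abscont_measurable (ltW lr) hZ.
    split; last by apply: eq_int_on => x _; rewrite lZ.
    apply: aeq_int; first exact: (aeq2 *%R (aeq_refl _ _ _) fZ).
      by apply: measurable_funM => //; case: sf.
    exact: measurable_funM.
  have [-> ->] := aux _ _ _ _ na0 hq1 sf1 sg1 rY1 rZ1 fZ1 lZ1.
  have [-> ->] := aux _ _ _ _ hb hq2 sf2 sg2 rY2 rZ2 fZ2 lZ2.
  rewrite -(green2 rY1 rY2 rZ1 rZ2); lra.
(* [k1] and [k2] are the defects in the interface conditions *)
pose k1 := rdot u w1 - (sgn1 * Q1 Z1 Z2 + th1 * P1 Z1 Z2).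
pose k2 := rdot v w2 - (sgn2 * Q2 Z1 Z2 + th2 * P2 Z1 Z2).
have bdry' A A' B B' p1 p2 u' v' : A * ca = A' * sa -> B * cb = B' * sb ->
  (B * jder Z2 b - B' * jval Z2 b) - (A * jder Z1 (- a) - A' * jval Z1 (- a))
  + p1 * k1 + p2 * k2 + (rdot u' (im1 Z1 Z2 u) - rdot u' s) + (rdot v' (im2 Z1 Z2 v) - rdot v' t) = 0.
  move=> hA hB; have [Y1 [Y2 [dY hp1 hp2 [yA yA'] [yB yB']]]] := dom_data p1 p2 u' v' hA hB.
  have := bdry _ _ _ _ dY; have [_ _ _ _ tY1 tY2] := dY.
  rewrite !rdot_rank1 [rdot u' (im1 _ _ _)]rdotC [rdot v' (im2 _ _ _)]rdotC !rdot_rank1.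
  rewrite (rdot_sym D1 u' u) (rdot_sym D2 v' v) -tY1 -tY2 yA yA' yB yB' hp1 hp2 /k1 /k2.
  by move=> h; rewrite -[RHS](subrr (rdot u' s + rdot v' t)) -{1}h; ring.
have z00 : 0 * ca = 0 * sa by rewrite !mul0r.
have z00' : 0 * cb = 0 * sb by rewrite !mul0r.
have rdelta k (i : 'I_k) x : rdot (fun j => (j == i)%:R) x = x i.
  rewrite /rdot (bigD1 i) //= eqxx mul1r big1 ?addr0 // => j /negbTE ->; exact: mul0r.
have hk1 : k1 = 0.
  by have := bdry' 0 0 0 0 1 0 (fun=> 0) (fun=> 0) z00 z00'; rewrite !rdot0 => <-; ring.
have hk2 : k2 = 0.
  by have := bdry' 0 0 0 0 0 1 (fun=> 0) (fun=> 0) z00 z00'; rewrite !rdot0 => <-; ring.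
exists Z1, Z2; split=> //; [split=> //|split].
- have := bdry' sa ca 0 0 0 0 (fun=> 0) (fun=> 0) (mulrC _ _) z00'; rewrite !rdot0 => h.
  by apply/eqP; rewrite -subr_eq0 -h; apply/eqP; ring.
- have := bdry' 0 0 sb cb 0 0 (fun=> 0) (fun=> 0) z00 (mulrC _ _); rewrite !rdot0 => h.
  by apply/eqP; rewrite -subr_eq0 -oppr0 -h; apply/eqP; ring.
- by apply/esym/eqP; rewrite -subr_eq0 -/k1 hk1.
- by apply/esym/eqP; rewrite -subr_eq0 -/k2 hk2.
- apply/funext => i; have := bdry' 0 0 0 0 0 0 (fun j => (j == i)%:R) (fun=> 0) z00 z00'.
  rewrite !rdot0 !rdelta => h; apply/esym/eqP; rewrite -subr_eq0 -h; apply/eqP; ring.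
- apply/funext => i; have := bdry' 0 0 0 0 0 0 (fun=> 0) (fun j => (j == i)%:R) z00 z00'.
  rewrite !rdot0 !rdelta => h; apply/esym/eqP; rewrite -subr_eq0 -h; apply/eqP; ring.
Qed.

(** A fixed function realizing the interface conditions for the given vectors,
    plus an [H^2_0] approximation of the difference on each side, which does not
    change the boundary data. *)
Lemma dom_dense f u v e : sqsummable_on (- a) 0 f -> sqsummable_on 0 b f -> 0 < e ->
  exists Y1 Y2, dom Y1 Y2 u v /\
    int_on (- a) 0 (fun x => (f x - jval Y1 x) ^+ 2) + int_on 0 b (fun x => (f x - jval Y2 x) ^+ 2) < e.
Proof.
move=> sf1 sf2 e0; have e20 : 0 < e / 2 by lra.
have z00 : 0 * ca = 0 * sa by rewrite !mul0r.
have z00' : 0 * cb = 0 * sb by rewrite !mul0r.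
have [Y1 [Y2 [dY hp1 hp2 [yA yA'] [yB yB']]]] := dom_data 0 0 u v z00 z00'.
have [[hY1 hY1' sY1] [hY2 hY2' sY2] bY1 bY2 tY1 tY2] := dY.
have aY1 := abscont_sq (ltW na0) hY1; have aY2 := abscont_sq (ltW hb) hY2.
have [z1 [z1' [z1'' [[rz1 rz1' sz1] z1a z1'a z10 z1'0]]] d1] := sq_approximable na0 (sqB sf1 aY1) e20.
have [z2 [z2' [z2'' [[rz2 rz2' sz2] z20 z2'0 z2b z2'b]]] d2] := sq_approximable hb (sqB sf2 aY2) e20.
exists (Jet (fun x => jval Y1 x + z1 x) (fun x => jder Y1 x + z1' x) (fun x => jder2 Y1 x + z1'' x)).
exists (Jet (fun x => jval Y2 x + z2 x) (fun x => jder Y2 x + z2' x) (fun x => jder2 Y2 x + z2'' x)).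
split; last first.
  rewrite /= (@eq_int_on _ (- a) 0 _ (fun x => (f x - jval Y1 x - z1 x) ^+ 2)) => [|x _]; last by congr (_ ^+ 2); ring.
  rewrite (@eq_int_on _ 0 b _ (fun x => (f x - jval Y2 x - z2 x) ^+ 2)) => [|x _]; last by congr (_ ^+ 2); ring.
  lra.
move: tY1 tY2; rewrite /P1 /Q1 /P2 /Q2 => tY1 tY2.
split; rewrite /P1 /Q1 /P2 /Q2 /= ?z1a ?z1'a ?z2b ?z2'b ?z10 ?z1'0 ?z20 ?z2'0 ?addr0 //.
- by split; [exact: abscontD|exact: abscontD|exact: sqD].
- by split; [exact: abscontD|exact: abscontD|exact: sqD].
Qed.

End RealOperator.

(** * Square summable functions and their classes *)

Section LspaceFacts.
Context {R : realType}.
Local Notation mu := (@lebesgue_measure R).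
Implicit Types (l r : R).

Lemma ae_lebesgue_on l r (P : R -> Prop) :
  {ae lebesgue_on l r, forall x : R, P x} -> {ae mu, forall x : R, x \in `]l, r[ -> P x}.
Proof.
move=> [N [mN N0 PN]]; exists (N `&` `]l, r[%classic); split.
- by apply: measurableI.
- exact: N0.
- by move=> x /= /not_implyP[xlr nP]; split=> //; apply: PN.
Qed.

Lemma lebesgue_on_integral l r (f : R -> \bar R) :
  (\int[lebesgue_on l r]_(x in `]l, r[) f x = \int[mu]_(x in `]l, r[) f x)%E.
Proof.
apply: eq_measure_integral => A mA AD.
by rewrite /= /mrestr; congr (mu _); apply/setIidPl.
Qed.

Lemma lebesgue_on_summable l r (f : R -> R) : measurable_fun `[l, r] f ->
  (lebesgue_on l r).-integrable `]l, r[ (EFin \o f) <-> summable_on l r f.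
Proof.
move=> mf.
have moo : measurable_fun `]l, r[ f.
  by apply: measurable_funS mf => //; exact: subset_itv_oo_cc.
split => /integrableP[_ fi]; apply/integrableP; split; try exact/measurable_EFinP.
- rewrite integral_itv_bndoo; last by do 2 apply: measurableT_comp => //.
  by rewrite -lebesgue_on_integral.
- rewrite lebesgue_on_integral.
  by rewrite -(@integral_itv_bndoo _ _ _ _ true false) //; do 2 apply: measurableT_comp => //.
Qed.

Lemma Lspace_sq l r (F : LspaceType2 (lebesgue_on l r)) : sqsummable_on l r (F : R -> R).
Proof.
pose F' : {mfun_ (lebesgue_on l r), measurableTypeR R >-> measurableTypeR R} := F.
have mF : measurable_fun setT (F : R -> R) := measurable_funPT (repr F').
have fin : finite_norm (lebesgue_on l r) 2%:E (F : R -> R) by exact: Lebesgue_finite.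
have mF' : measurable_fun `[l, r] (F : R -> R) by exact: measurable_funTS.
have /Lfun2_integrable_sqr iF : (F : R -> R) \in Lfun (lebesgue_on l r) 2%:E.
  by rewrite inE; apply/andP; split; rewrite inE.
split=> //; apply/lebesgue_on_summable; first exact: measurable_funX.
by apply: integrableS iF.
Qed.

(** The class of the extension of [f] by zero. *)
Lemma Lspace_of l r (f : R -> R) : sqsummable_on l r f ->
  exists F : LspaceType2 (lebesgue_on l r), aeq l r (F : R -> R) f.
Proof.
move=> [mf sf].
pose f0 : R -> R := f \_ `]l, r[.
have mf0 : measurable_fun setT f0.
  apply/(measurable_restrictT _ (measurable_itv _)).
  by apply: measurable_funS mf => //; exact: subset_itv_oo_cc.
pose g : {mfun measurableTypeR R >-> measurableTypeR R} := 
  MeasurableFun.Pack (MeasurableFun.Class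
    (isMeasurableFun.Build _ _ (measurableTypeR R) (measurableTypeR R) f0 mf0)).
pose F0 : {mfun_ (lebesgue_on l r), measurableTypeR R >-> measurableTypeR R} :=
  (\pi_(@aeEqMfun _ _ R (measurableTypeR R) (measurableTypeR R) (lebesgue_on l r)) g)%qT.
have aeF : {ae lebesgue_on l r, forall x : R, (F0 : R -> R) x = f0 x}.
  have : (repr F0 = g %[mod @aeEqMfun _ _ R (measurableTypeR R) (measurableTypeR R) (lebesgue_on l r)])%qT by rewrite reprK.
  move/eqmodP => /asboolP; apply: filterS => x; exact.
have fin : finite_norm (lebesgue_on l r) 2%:E (F0 : R -> R).
  have mF0 : measurable_fun setT (F0 : R -> R) := measurable_funPT (repr F0).
  have /integrableP[_] := (@lebesgue_on_summable l r _ (measurable_funX 2 mf)).2 sf.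
  rewrite /finite_norm unlock /Lnorm => h; rewrite poweR_lty //.
  apply: le_lt_trans h; rewrite le_eqVlt; apply/predU1P; left.
  rewrite [RHS]integral_mkcond.
  have mpow (h : R -> R) : measurable_fun setT h -> measurable_fun setT (fun x => (`|(EFin \o h) x| `^ 2)%E).
    move=> mh; apply: (measurableT_comp (measurable_poweR 2)).
    by apply: measurableT_comp => //; exact/measurable_EFinP.
  rewrite (@ae_eq_integral _ _ _ (lebesgue_on l r) _ (fun x => (`|(EFin \o f0) x| `^ 2)%E)) //.
  - apply: eq_integral => x _; rewrite /f0 /= !patchE; case: ifP => _ /=.
      by rewrite powR_mulrn // normrX.
    by rewrite normr0 powR0.
  - exact: mpow.
  - exact: mpow.
  - have flt : Filter (almost_everywhere (lebesgue_on l r)) := ae_filter_ringOfSetsType _.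
    by move: aeF; apply: filterS => x /= ->.
pose F : LspaceType2 (lebesgue_on l r) := 
  LebesgueSpace.Pack (LebesgueSpace.Class (isFinLebesgue.Build _ _ _ _ _ _ F0 fin)).
exists F.
have := ae_lebesgue_on aeF; rewrite /aeq; apply: filterS => x + xlr => /(_ xlr) ->.
by rewrite /f0 patchE mem_set.
Qed.
End LspaceFacts.

(** * Real and imaginary parts *)

Section Parts.
Local Open Scope complex_scope.
Context {R : realType}.
Local Notation mu := (@lebesgue_measure R).

(** One index for the real and the imaginary part, so that what holds for both
    is stated and proved once. *)
Definition cpart (t : bool) (z : R[i]) : R := if t then complex.Im z else complex.Re z.

Definition fpart t (f : R -> R[i]) : R -> R := fun x => cpart t (f x).

Definition vpart n t (v : 'rV[R[i]]_n) : 'I_n -> R := fun i => cpart t (v 0 i).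

Lemma eq_cparts (z w : R[i]) : (forall t, cpart t z = cpart t w) -> z = w.
Proof. by case: z w => [x y] [x' y'] h; move: (h false) (h true) => /= -> ->. Qed.

Lemma cpart0 t : cpart t 0 = 0. Proof. by case: t. Qed.

Lemma cpartD t (z w : R[i]) : cpart t (z + w) = cpart t z + cpart t w.
Proof. by case: t; case: z w => [x y] [x' y']. Qed.

Lemma cpartN t (z : R[i]) : cpart t (- z) = - cpart t z.
Proof. by case: t; case: z. Qed.

Lemma cpartB t (z w : R[i]) : cpart t (z - w) = cpart t z - cpart t w.
Proof. by rewrite cpartD cpartN. Qed.

Lemma cpartZ t c (z : R[i]) : cpart t (c%:C * z) = c * cpart t z.
Proof. by case: t; case: z => x y; simpc. Qed.

Lemma cpartZr t c (z : R[i]) : cpart t (z * c%:C) = cpart t z * c.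
Proof. by rewrite mulrC cpartZ mulrC. Qed.

Lemma cpart_sum t n (F : 'I_n -> R[i]) : cpart t (\sum_(i < n) F i) = \sum_(i < n) cpart t (F i).
Proof. exact: (big_morph (cpart t) (cpartD t) (cpart0 t)). Qed.

Lemma num_conjE (z : R[i]) : Num.conj z = complex.Re z -i* complex.Im z.
Proof. by case: z. Qed.

Lemma cpart_cdot_realv t n (v : 'rV[R[i]]_n) (w : 'I_n -> R) :
  cpart t (cdot v (realv w)) = rdot (vpart t v) w.
Proof.
rewrite /cdot cpart_sum; apply: eq_bigr => i _; rewrite /realv mxE.
have -> : Num.conj (w i)%:C = (w i)%:C by rewrite num_conjE /= oppr0.
exact: cpartZr.
Qed.

Lemma vpart_image t n (p : R[i]) (w D : 'I_n -> R) (v : 'rV[R[i]]_n) i :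
  vpart t (p *: realv w + v *m diagv D) i = cpart t p * w i + vpart t v i * D i.
Proof. by rewrite /vpart /diagv mul_mx_diag !mxE cpartD !cpartZr. Qed.

Lemma cpart_cdot_re n (v w : 'rV[R[i]]_n) :
  cpart false (cdot v w) = rdot (vpart false v) (vpart false w) + rdot (vpart true v) (vpart true w).
Proof.
rewrite /cdot cpart_sum /rdot -big_split; apply: eq_bigr => i _.
by rewrite /vpart num_conjE; case: (v 0 i) (w 0 i) => [x y] [x' y'] /=; simpc => /=; ring.
Qed.

Lemma cpart_cdot_im n (v w : 'rV[R[i]]_n) :
  cpart true (cdot v w) = rdot (vpart true v) (vpart false w) - rdot (vpart false v) (vpart true w).
Proof.
rewrite /cdot cpart_sum /rdot -sumrB; apply: eq_bigr => i _.
by rewrite /vpart num_conjE; case: (v 0 i) (w 0 i) => [x y] [x' y'] /=; simpc => /=; ring.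
Qed.

Lemma cpart_lim_right t (f : R -> R[i]) x : cpart t (lim_right f x) = lim (fpart t f y @[y --> x^'+]).
Proof. by case: t. Qed.

Lemma cpart_lim_left t (f : R -> R[i]) x : cpart t (lim_left f x) = lim (fpart t f y @[y --> x^'-]).
Proof. by case: t. Qed.

Lemma fpart_ell t q (y y'' : R -> R[i]) x :
  fpart t (fun x => - y'' x + (q x)%:C * y x) x = - fpart t y'' x + q x * fpart t y x.
Proof. by rewrite /fpart cpartD cpartN cpartZ. Qed.

End Parts.

Section InnerProduct.
Local Open Scope complex_scope.
Context {R : realType}.
Local Notation mu := (@lebesgue_measure R).
Variables (a b : R) (ha : 0 < a) (hb : 0 < b) (n m : nat).

(** The real bilinear form from which the real and the imaginary part of the
    inner product are built. *)
Definition rform (f : R -> R) (u : 'I_n -> R) (v : 'I_m -> R)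
    (g : R -> R) (s : 'I_n -> R) (t : 'I_m -> R) :=
  int_on (- a) 0 (fun x => f x * g x) + int_on 0 b (fun x => f x * g x) + rdot u s + rdot v t.

Lemma int_oo f : summable_on (- a) b f ->
  (\int[mu]_(x in `](- a), b[) f x)%R = int_on (- a) 0 f + int_on 0 b f.
Proof.
move=> hf; have na : - a <= 0 by rewrite oppr_le0 ltW.
rewrite -(int_on_split na (ltW hb) hf) /int_on.
rewrite Rintegral_itv_obnd_cbnd ?Rintegral_itv_bndo_bndc //.
all: by apply: integrableS hf => //; apply: subset_itv; rewrite bnd_simp.
Qed.

Lemma pre_inner_re (y z : R -> R[i]) (y1 z1 : 'rV[R[i]]_n) (y2 z2 : 'rV[R[i]]_m) :
  (forall t, sqsummable_on (- a) b (fpart t y)) -> (forall t, sqsummable_on (- a) b (fpart t z)) ->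
  cpart false (pre_inner a b y y1 y2 z z1 z2) =
  rform (fpart false y) (vpart false y1) (vpart false y2) (fpart false z) (vpart false z1) (vpart false z2) +
  rform (fpart true y) (vpart true y1) (vpart true y2) (fpart true z) (vpart true z1) (vpart true z2).
Proof.
move=> sy sz; rewrite /pre_inner !cpartD !cpart_cdot_re /rform.
have -> : cpart false (Cintegral `](- a), b[ (fun x => y x * Num.conj (z x))) =
  (\int[mu]_(x in `](- a), b[) (fpart false y x * fpart false z x + fpart true y x * fpart true z x))%R.
  apply: eq_Rintegral => x _; rewrite /Cre /fpart num_conjE.
  by case: (y x) (z x) => [? ?] [? ?] /=; simpc => /=; ring.
have s1 := sq_mul (sy false) (sz false); have s2 := sq_mul (sy true) (sz true).
rewrite int_oo; last exact: summable_onD.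
have na : - a <= 0 by rewrite oppr_le0 ltW.
have sub1 f := @summable_sub R (- a) b (- a) 0 f (lexx _) (ltW hb).
have sub2 f := @summable_sub R (- a) b 0 b f na (lexx _).
rewrite (int_onD (sub1 _ s1) (sub1 _ s2)) (int_onD (sub2 _ s1) (sub2 _ s2)).
ring.
Qed.

Lemma pre_inner_im (y z : R -> R[i]) (y1 z1 : 'rV[R[i]]_n) (y2 z2 : 'rV[R[i]]_m) :
  (forall t, sqsummable_on (- a) b (fpart t y)) -> (forall t, sqsummable_on (- a) b (fpart t z)) ->
  cpart true (pre_inner a b y y1 y2 z z1 z2) =
  rform (fpart true y) (vpart true y1) (vpart true y2) (fpart false z) (vpart false z1) (vpart false z2) -
  rform (fpart false y) (vpart false y1) (vpart false y2) (fpart true z) (vpart true z1) (vpart true z2).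
Proof.
move=> sy sz; rewrite /pre_inner !cpartD !cpart_cdot_im /rform.
have -> : cpart true (Cintegral `](- a), b[ (fun x => y x * Num.conj (z x))) =
  (\int[mu]_(x in `](- a), b[) (fpart true y x * fpart false z x - fpart false y x * fpart true z x))%R.
  apply: eq_Rintegral => x _; rewrite /Cim /fpart num_conjE.
  by case: (y x) (z x) => [? ?] [? ?] /=; simpc => /=; ring.
have s1 := sq_mul (sy true) (sz false); have s2 := sq_mul (sy false) (sz true).
rewrite int_oo; last exact: summable_onB.
have na : - a <= 0 by rewrite oppr_le0 ltW.
have sub1 f := @summable_sub R (- a) b (- a) 0 f (lexx _) (ltW hb).
have sub2 f := @summable_sub R (- a) b 0 b f na (lexx _).
rewrite (int_onB (sub1 _ s1) (sub1 _ s2)) (int_onB (sub2 _ s1) (sub2 _ s2)).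
ring.
Qed.

Definition hpart t (Y : hspace a b n m) : R -> R := if t then him Y : R -> R else hre Y : R -> R.

Lemma fpart_hfun t (Y : hspace a b n m) : fpart t (hfun Y) = hpart t Y.
Proof. by case: t. Qed.

Lemma hpart_sq t (Y : hspace a b n m) : sqsummable_on (- a) b (hpart t Y).
Proof. by case: t; exact: Lspace_sq. Qed.

Lemma hspace_of (f : bool -> R -> R) (v1 : 'rV[R[i]]_n) (v2 : 'rV[R[i]]_m) :
  (forall t, sqsummable_on (- a) b (f t)) ->
  exists Y : hspace a b n m, [/\ forall t, aeq (- a) b (hpart t Y) (f t), hv1 Y = v1 & hv2 Y = v2].
Proof.
move=> sf; have [F0 h0] := Lspace_of (sf false); have [F1 h1] := Lspace_of (sf true).
by exists (HVec F0 F1 v1 v2); split=> // -[].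
Qed.

End InnerProduct.

(** * Self-adjointness *)

Section Complexification.
Local Open Scope complex_scope.
Context {R : realType}.
Local Notation mu := (@lebesgue_measure R).

Lemma ell_regular_part t l r (q : R -> R) y y' y'' : l < r -> sqsummable_on l r q ->
  ell_regular q l r y y' y'' ->
  exists Y, [/\ jreg l r Y, jder2 Y = fpart t y'', (forall x, l < x < r -> fpart t y x = jval Y x) &
    (forall x, l < x < r -> fpart t y' x = jder Y x)].
Proof.
move=> lr hq [hy hy' _ sy' sl].
have h1 : ac_deriv l r (fpart t y) (fpart t y') by case: (t); case: hy.
have h2 : ac_deriv l r (fpart t y') (fpart t y'') by case: (t); case: hy'.
have h3 : L2on l r (fpart t y') by case: (t); case: sy'.
have h4 : L2on l r (fun x => - fpart t y'' x + q x * fpart t y x).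
  have -> : (fun x => - fpart t y'' x + q x * fpart t y x) = fpart t (fun x => - y'' x + (q x)%:C * y x).
    by apply/funext => x; rewrite fpart_ell.
  by case: (t); case: sl.
have [Y [Y' [rY yY yY']]] := ac_deriv_reg lr hq h1 h2 h3 h4.
by exists (Jet Y Y' (fpart t y'')).
Qed.

Lemma ell_regular_of l r (q : R -> R) y y' y'' (Y : bool -> jet R) : l < r -> sqsummable_on l r q ->
  (forall t, jreg l r (Y t)) ->
  (forall t x, l < x < r -> fpart t y x = jval (Y t) x) ->
  (forall t x, l < x < r -> fpart t y' x = jder (Y t) x) ->
  (forall t x, l < x < r -> fpart t y'' x = jder2 (Y t) x) ->
  ell_regular q l r y y' y''.
Proof.
move=> lr hq rY yY y'Y y''Y.
have part t : [/\ ac_deriv l r (fpart t y) (fpart t y'), ac_deriv l r (fpart t y') (fpart t y''),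
    L2on l r (fpart t y), L2on l r (fpart t y') &
    L2on l r (fpart t (fun x => - y'' x + (q x)%:C * y x))].
  have -> : fpart t (fun x => - y'' x + (q x)%:C * y x) = (fun x => - fpart t y'' x + q x * fpart t y x).
    by apply/funext => x; rewrite fpart_ell.
  apply: (reg_ac_deriv lr hq _ (yY t) (y'Y t)).
  apply: reg_ext (rY t) => x xlr; by rewrite y''Y.
by have [? ? ? ? ?] := part false; have [? ? ? ? ?] := part true.
Qed.

Lemma jlim_right l r (f : R -> R[i]) t (F F' : R -> R) : l < r -> abscont l r F F' ->
  (forall x, l < x < r -> fpart t f x = F x) -> cpart t (lim_right f l) = F l.
Proof.
move=> lr hF fF; rewrite cpart_lim_right; apply: cvg_lim => //.
exact: abscont_cvg_right lr hF fF.
Qed.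

Lemma jlim_left l r (f : R -> R[i]) t (F F' : R -> R) : l < r -> abscont l r F F' ->
  (forall x, l < x < r -> fpart t f x = F x) -> cpart t (lim_left f r) = F r.
Proof.
move=> lr hF fF; rewrite cpart_lim_left; apply: cvg_lim => //.
exact: abscont_cvg_left lr hF fF.
Qed.

Lemma trace1P (s : bool) (sg x : R) (yp y'p y'm k : R[i]) :
  (if s then - yp + sg%:C * (y'p - y'm) - k = 0 else (y'p - y'm) - x%:C * yp - k = 0) <->
  forall t, (if s then - 1 else 1) * (if s then cpart t yp else cpart t y'p - cpart t y'm) +
    (if s then sg else - x) * (if s then cpart t y'p - cpart t y'm else cpart t yp) = cpart t k.
Proof.
case: s; split=> [h t|h].
- have := congr1 (cpart t) h; rewrite cpartB cpartD cpartN cpartZ cpartB cpart0; lra.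
- by apply: eq_cparts => t; have := h t; rewrite cpartB cpartD cpartN cpartZ cpartB cpart0; lra.
- have := congr1 (cpart t) h; rewrite !cpartB cpartZ cpart0; lra.
- by apply: eq_cparts => t; have := h t; rewrite !cpartB cpartZ cpart0; lra.
Qed.

Lemma trace2P (s : bool) (ta x : R) (yp ym y'm k : R[i]) :
  (if s then y'm - ta%:C * (yp - ym) - k = 0 else - (yp - ym) + x%:C * y'm - k = 0) <->
  forall t, (if s then 1 else - 1) * (if s then cpart t y'm else cpart t yp - cpart t ym) +
    (if s then - ta else x) * (if s then cpart t yp - cpart t ym else cpart t y'm) = cpart t k.
Proof.
case: s; split=> [h t|h].
- have := congr1 (cpart t) h; rewrite !cpartB cpartZ cpartB cpart0; lra.
- by apply: eq_cparts => t; have := h t; rewrite !cpartB cpartZ cpartB cpart0; lra.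
- have := congr1 (cpart t) h; rewrite cpartB cpartD cpartN cpartZ cpartB cpart0; lra.
- by apply: eq_cparts => t; have := h t; rewrite cpartB cpartD cpartN cpartZ cpartB cpart0; lra.
Qed.

Variables (a b : R) (ha : 0 < a) (hb : 0 < b) (q : R -> R) (hq : sqsummable_on (- a) b q).
Variables (alpha beta : R) (N M N' M' : nat) (eta kappa xi zeta : R).
Variables (c bv : 'I_N -> R) (d av : 'I_M -> R) (sigma : R) (gamma betav : 'I_N' -> R).
Variables (tau : R) (delta alphav : 'I_M' -> R).

Let n := star_dim (0 < eta) N' N.
Let m := star_dim (0 < kappa) M' M.
Let w1 : 'I_n -> R := star_vec (0 < eta) betav bv.
Let D1 : 'I_n -> R := star_vec (0 < eta) gamma c.
Let w2 : 'I_m -> R := star_vec (0 < kappa) alphav av.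
Let D2 : 'I_m -> R := star_vec (0 < kappa) delta d.
Let th1 := if 0 < eta then sigma else - xi.
Let th2 := if 0 < kappa then - tau else zeta.
Let na0 : - a < 0. Proof. by rewrite oppr_lt0. Qed.
Let sub1 f : sqsummable_on (- a) b f -> sqsummable_on (- a) 0 f := sq_sub (lexx _) (ltW hb).
Let sub2 f : sqsummable_on (- a) b f -> sqsummable_on 0 b f := sq_sub (ltW na0) (lexx _).
Let hq1 : sqsummable_on (- a) 0 q := sub1 hq.
Let hq2 : sqsummable_on 0 b q := sub2 hq.

Notation rdom := (dom a b (cos alpha) (sin alpha) (cos beta) (sin beta)
  (0 < eta) (0 < kappa) th1 th2 w1 w2).
Notation rim1 := (im1 (0 < eta) w1 D1).
Notation rim2 := (im2 (0 < kappa) w2 D2).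
Notation L := (@opL R a b q alpha beta N M N' M' eta kappa xi zeta c bv d av
       sigma gamma betav tau delta alphav).

(** As all coefficients are real, the operator acts separately on real and
    imaginary parts, by this relation. *)
Definition real_graph f u v g s t := exists Y1 Y2,
  [/\ rdom Y1 Y2 u v, aeq (- a) 0 f (jval Y1) /\ aeq 0 b f (jval Y2),
      aeq (- a) 0 g (jell q Y1) /\ aeq 0 b g (jell q Y2) &
      s = rim1 Y1 Y2 u /\ t = rim2 Y1 Y2 v].

Lemma opL_parts (Y W : hspace a b n m) : L Y W ->
  forall t, real_graph (hpart t Y) (vpart t (hv1 Y)) (vpart t (hv2 Y))
    (hpart t W) (vpart t (hv1 W)) (vpart t (hv2 W)).
Proof.
move=> [y [y' [y'' [[hY rl rr] [bc1 bc2] tr1 tr2 [hW im1W im2W]]]]] t.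
have [Y1 [rY1 Y1'' yY1 y'Y1]] := ell_regular_part t na0 hq1 rl.
have [Y2 [rY2 Y2'' yY2 y'Y2]] := ell_regular_part t hb hq2 rr.
have [aY1 aY1' _] := rY1; have [aY2 aY2' _] := rY2.
have la := jlim_right na0 aY1 yY1; have l'a := jlim_right na0 aY1' y'Y1.
have l0m := jlim_left na0 aY1 yY1; have l'0m := jlim_left na0 aY1' y'Y1.
have l0p := jlim_right hb aY2 yY2; have l'0p := jlim_right hb aY2' y'Y2.
have lb := jlim_left hb aY2 yY2; have l'b := jlim_left hb aY2' y'Y2.
have hYt : aeq (- a) b (hpart t Y) (fpart t y).
  by move: hY; rewrite /aeq; apply: filterS => x h /h; rewrite -fpart_hfun /fpart => ->.
have hWt : aeq (- a) b (hpart t W) (fun x => - fpart t y'' x + q x * fpart t y x).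
  move: hW; rewrite /aeq; apply: filterS => x h /h; rewrite -fpart_hfun -fpart_ell /fpart => ->.
  by [].
have aeql f g := @aeq_sub R (- a) b (- a) 0 f g (lexx _) (ltW hb).
have aeqr f g := @aeq_sub R (- a) b 0 b f g (ltW na0) (lexx _).
exists Y1, Y2; split.
- split=> //.
  + by rewrite -la -l'a -!cpartZr bc1.
  + by rewrite -lb -l'b -!cpartZr bc2.
  + rewrite -cpart_cdot_realv; have /trace1P/(_ t) := tr1.
    by rewrite l0p l'0p l'0m.
  + rewrite -cpart_cdot_realv; have /trace2P/(_ t) := tr2.
    by rewrite l0p l'0m l0m.
- split; [exact: aeq_trans (aeql _ _ hYt) (aeq_in yY1)|exact: aeq_trans (aeqr _ _ hYt) (aeq_in yY2)].
- split; [apply: aeq_trans (aeql _ _ hWt) _|apply: aeq_trans (aeqr _ _ hWt) _].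
  + by apply: aeq_in => x xlr; rewrite /jell Y1'' yY1.
  + by apply: aeq_in => x xlr; rewrite /jell Y2'' yY2.
- split; apply/funext => i.
  + rewrite im1W vpart_image /im1 /P1; congr (_ * _ + _).
    by case: (0 < eta); rewrite ?cpartB ?l0p ?l'0p ?l'0m.
  + rewrite im2W vpart_image /im2 /P2; congr (_ * _ + _).
    by case: (0 < kappa); rewrite ?cpartB ?l0p ?l'0m ?l0m.
Qed.

(** The representative is glued from the two parts on the two sides of 0; its
    value at 0 is irrelevant almost everywhere. *)
Lemma opL_of_parts (Y W : hspace a b n m) :
  (forall t, real_graph (hpart t Y) (vpart t (hv1 Y)) (vpart t (hv2 Y))
    (hpart t W) (vpart t (hv1 W)) (vpart t (hv2 W))) -> L Y W.
Proof.
move=> h.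
have /choice[Y1 /choice[Y2 h12]] : forall t, exists Y1, exists Y2,
  [/\ rdom Y1 Y2 (vpart t (hv1 Y)) (vpart t (hv2 Y)),
      aeq (- a) 0 (hpart t Y) (jval Y1) /\ aeq 0 b (hpart t Y) (jval Y2),
      aeq (- a) 0 (hpart t W) (jell q Y1) /\ aeq 0 b (hpart t W) (jell q Y2) &
      vpart t (hv1 W) = rim1 Y1 Y2 (vpart t (hv1 Y)) /\ vpart t (hv2 W) = rim2 Y1 Y2 (vpart t (hv2 Y))].
  by move=> t; have [Y1 [Y2 h12]] := h t; exists Y1, Y2.
pose glue (p : jet R -> R -> R) (x : R) : R[i] :=
  (if x < 0 then p (Y1 false) x else p (Y2 false) x) +i*
  (if x < 0 then p (Y1 true) x else p (Y2 true) x).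
have glueE p t x : fpart t (glue p) x = if x < 0 then p (Y1 t) x else p (Y2 t) x by case: t.
have glue1 p t x : - a < x < 0 -> fpart t (glue p) x = p (Y1 t) x.
  by rewrite glueE => /andP[_ ->].
have glue2 p t x : 0 < x < b -> fpart t (glue p) x = p (Y2 t) x.
  by rewrite glueE => /andP[x0 _]; rewrite ltNge ltW.
have r1 t : jreg (- a) 0 (Y1 t) by case: (h12 t) => -[].
have r2 t : jreg 0 b (Y2 t) by case: (h12 t) => -[].
have aY1 t : abscont (- a) 0 (jval (Y1 t)) (jder (Y1 t)) by case: (r1 t).
have aY1' t : abscont (- a) 0 (jder (Y1 t)) (jder2 (Y1 t)) by case: (r1 t).
have aY2 t : abscont 0 b (jval (Y2 t)) (jder (Y2 t)) by case: (r2 t).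
have aY2' t : abscont 0 b (jder (Y2 t)) (jder2 (Y2 t)) by case: (r2 t).
set y := glue (@jval R); set y' := glue (@jder R); set y'' := glue (@jder2 R).
have la t := jlim_right na0 (aY1 t) (glue1 (@jval R) t).
have l'a t := jlim_right na0 (aY1' t) (glue1 (@jder R) t).
have l0m t := jlim_left na0 (aY1 t) (glue1 (@jval R) t).
have l'0m t := jlim_left na0 (aY1' t) (glue1 (@jder R) t).
have l0p t := jlim_right hb (aY2 t) (glue2 (@jval R) t).
have l'0p t := jlim_right hb (aY2' t) (glue2 (@jder R) t).
have lb t := jlim_left hb (aY2 t) (glue2 (@jval R) t).
have l'b t := jlim_left hb (aY2' t) (glue2 (@jder R) t).
have ae_glue (F : R -> R[i]) (G : R -> R[i]) :
    (forall t, aeq (- a) 0 (fpart t F) (fpart t G)) -> (forall t, aeq 0 b (fpart t F) (fpart t G)) ->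
    {ae mu, forall x : R, x \in `](- a), b[ -> F x = G x}.
  move=> h1 h2.
  have both t : {ae mu, forall x : R, x \in `](- a), b[ -> fpart t F x = fpart t G x}.
    move: (ae_neq (0 : R)) (h1 t) (h2 t); rewrite /aeq; apply: filterS3 => x x0 g1 g2.
    rewrite in_itv /= => /andP[ax xb]; case: (ltgtP x 0) => [x0'|x0'|//].
      by apply: g1; rewrite in_itv /= ax.
    by apply: g2; rewrite in_itv /= x0'.
  move: (both false) (both true); apply: filterS2 => x h3 h4 xab.
  by apply: eq_cparts => -[]; [exact: h4|exact: h3].
exists y, y', y''; split.
- split.
  + apply: ae_glue => t; rewrite fpart_hfun; have [_ [h1 h2] _ _] := h12 t.
      by apply: aeq_trans h1 _; apply: aeq_in => x xlr; rewrite glue1.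
    by apply: aeq_trans h2 _; apply: aeq_in => x xlr; rewrite glue2.
  + by apply: ell_regular_of r1 _ _ _ => // t x; exact: glue1.
  + by apply: ell_regular_of r2 _ _ _ => // t x; exact: glue2.
- split; apply: eq_cparts => t; have [[_ _ bc1 bc2 _ _] _ _ _] := h12 t.
  + by rewrite !cpartZr la l'a.
  + by rewrite !cpartZr lb l'b.
- apply/trace1P => t; rewrite l0p l'0p l'0m cpart_cdot_realv.
  by have [[_ _ _ _ tr _] _ _ _] := h12 t.
- apply/trace2P => t; rewrite l0p l'0m l0m cpart_cdot_realv.
  by have [[_ _ _ _ _ tr] _ _ _] := h12 t.
- split.
  + apply: ae_glue => t; rewrite fpart_hfun; have [_ _ [h1 h2] _] := h12 t.
      by apply: aeq_trans h1 _; apply: aeq_in => x xlr; rewrite fpart_ell !glue1.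
    by apply: aeq_trans h2 _; apply: aeq_in => x xlr; rewrite fpart_ell !glue2.
  + apply/rowP => i; apply: eq_cparts => t; have [_ _ _ [h1 _]] := h12 t.
    rewrite -[LHS]/(vpart t (hv1 W) i) h1 -[RHS]/(vpart t _ i) vpart_image /im1 /P1.
    congr (_ * _ + _).
    by case: (0 < eta); rewrite ?cpartB ?l0p ?l'0p ?l'0m.
  + apply/rowP => i; apply: eq_cparts => t; have [_ _ _ [_ h1]] := h12 t.
    rewrite -[LHS]/(vpart t (hv2 W) i) h1 -[RHS]/(vpart t _ i) vpart_image /im2 /P2.
    congr (_ * _ + _).
    by case: (0 < kappa); rewrite ?cpartB ?l0p ?l'0m ?l0m.
Qed.

Lemma rform_aeq (f f1 f2 g : R -> R) u v s t : sqsummable_on (- a) b f -> sqsummable_on (- a) b g ->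
  sqsummable_on (- a) 0 f1 -> sqsummable_on 0 b f2 -> aeq (- a) 0 f f1 -> aeq 0 b f f2 ->
  rform a b f u v g s t =
  int_on (- a) 0 (fun x => f1 x * g x) + int_on 0 b (fun x => f2 x * g x) + @rdot R n u s + @rdot R m v t.
Proof.
move=> sf sg s1 s2 h1 h2; rewrite /rform.
congr (_ + _ + _ + _); apply: aeq_int; try exact: (aeq2 *%R _ (aeq_refl _ _ _)).
- exact: measurable_funM (sub1 sf).1 (sub1 sg).1.
- exact: measurable_funM s1.1 (sub1 sg).1.
- exact: measurable_funM (sub2 sf).1 (sub2 sg).1.
- exact: measurable_funM s2.1 (sub2 sg).1.
Qed.

Lemma jreg_sq l r Y : l <= r -> sqsummable_on l r q -> jreg l r Y -> sqsummable_on l r (jval Y) /\ sqsummable_on l r (jell q Y).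
Proof.
move=> lr sq_q [hY _ sY]; split; first exact: abscont_sq hY.
have := sqB (sq_mul_abscont lr sq_q hY) sY; congr sqsummable_on; apply/funext => x.
by rewrite /jell addrC.
Qed.

Lemma real_graph_symmetric f u v g s t f' u' v' g' s' t' :
  sqsummable_on (- a) b f -> sqsummable_on (- a) b g -> sqsummable_on (- a) b f' -> sqsummable_on (- a) b g' ->
  real_graph f u v g s t -> real_graph f' u' v' g' s' t' ->
  rform a b g s t f' u' v' = rform a b f u v g' s' t'.
Proof.
move=> sf sg sf' sg' [Y1 [Y2 [dY [f1 f2] [g1 g2] [-> ->]]]] [Z1 [Z2 [dZ [f1' f2'] [g1' g2'] [-> ->]]]].
have [rY1 rY2 _ _ _ _] := dY; have [rZ1 rZ2 _ _ _ _] := dZ.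
have [sY1 lY1] := jreg_sq (ltW na0) hq1 rY1; have [sY2 lY2] := jreg_sq (ltW hb) hq2 rY2.
have [sZ1 lZ1] := jreg_sq (ltW na0) hq1 rZ1; have [sZ2 lZ2] := jreg_sq (ltW hb) hq2 rZ2.
rewrite (rform_aeq _ _ _ _ sg sf' lY1 lY2 g1 g2) (rform_aeq _ _ _ _ sf sg' sY1 sY2 f1 f2).
have aux l r (h k k' : R -> R) : sqsummable_on l r h -> sqsummable_on l r k -> sqsummable_on l r k' -> aeq l r k k' ->
    int_on l r (fun x => h x * k x) = int_on l r (fun x => h x * k' x).
  move=> sh sk sk' kk'; apply: aeq_int; first exact: (aeq2 *%R (aeq_refl _ _ _) kk').
    exact: measurable_funM sh.1 sk.1.
  exact: measurable_funM sh.1 sk'.1.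
rewrite (aux _ _ _ _ _ lY1 (sub1 sf') sZ1 f1') (aux _ _ _ _ _ lY2 (sub2 sf') sZ2 f2').
rewrite (aux _ _ _ _ _ sY1 (sub1 sg') lZ1 g1') (aux _ _ _ _ _ sY2 (sub2 sg') lZ2 g2').
exact: (dom_symmetric ha hb hq1 hq2 (cos2Dsin2 _) (cos2Dsin2 _) D1 D2 dY dZ).
Qed.

Lemma L_symmetric (Y V Z W : hspace a b n m) : L Y V -> L Z W -> inner V Z = inner Y W.
Proof.
move=> /opL_parts hY /opL_parts hZ.
have h t1 t2 := real_graph_symmetric (hpart_sq t1 Y) (hpart_sq t1 V) (hpart_sq t2 Z) (hpart_sq t2 W)
  (hY t1) (hZ t2).
have sh (F : hspace a b n m) t : sqsummable_on (- a) b (fpart t (hfun F)) by rewrite fpart_hfun; exact: hpart_sq.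
apply: eq_cparts => -[]; rewrite /inner.
- by rewrite !pre_inner_im // !fpart_hfun !h.
- by rewrite !pre_inner_re // !fpart_hfun !h.
Qed.

(** Produces the elements of the domain used for testing and for approximation. *)
Lemma element_of (Y1 Y2 : bool -> jet R) u v : (forall t, rdom (Y1 t) (Y2 t) (u t) (v t)) ->
  exists Y V : hspace a b n m, [/\ L Y V,
    forall t, aeq (- a) 0 (hpart t Y) (jval (Y1 t)) /\ aeq 0 b (hpart t Y) (jval (Y2 t)),
    forall t, aeq (- a) 0 (hpart t V) (jell q (Y1 t)) /\ aeq 0 b (hpart t V) (jell q (Y2 t)),
    forall t, vpart t (hv1 Y) = u t /\ vpart t (hv2 Y) = v t &
    forall t, vpart t (hv1 V) = rim1 (Y1 t) (Y2 t) (u t) /\ vpart t (hv2 V) = rim2 (Y1 t) (Y2 t) (v t)].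
Proof.
move=> hdom.
have r1 t : jreg (- a) 0 (Y1 t) by case: (hdom t).
have r2 t : jreg 0 b (Y2 t) by case: (hdom t).
pose glue (p : jet R -> R -> R) t x := if x < 0 then p (Y1 t) x else p (Y2 t) x.
have glue1 p t x : - a < x < 0 -> p (Y1 t) x = glue p t x by rewrite /glue => /andP[_ ->].
have glue2 p t x : 0 < x < b -> p (Y2 t) x = glue p t x.
  by rewrite /glue => /andP[x0 _]; rewrite ltNge ltW.
have sglue p : (forall t, sqsummable_on (- a) 0 (p (Y1 t))) -> (forall t, sqsummable_on 0 b (p (Y2 t))) ->
    forall t, sqsummable_on (- a) b (glue p t).
  move=> h1 h2 t; apply: (@sq_join R (- a) 0 b); [exact: ltW|exact: ltW|..].
    exact: aeq_sq (aeq_in (glue1 p t)) (eq_oo_measurable (glue1 p t) (h1 t).1) (h1 t).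
  exact: aeq_sq (aeq_in (glue2 p t)) (eq_oo_measurable (glue2 p t) (h2 t).1) (h2 t).
have s1 t := jreg_sq (ltW na0) hq1 (r1 t); have s2 t := jreg_sq (ltW hb) hq2 (r2 t).
pose row k (w : bool -> 'I_k -> R) : 'rV[R[i]]_k := \row_i (w false i +i* w true i).
have rowE k (w : bool -> 'I_k -> R) t : vpart t (row k w) = w t.
  by apply/funext => i; rewrite /vpart mxE; case: t.
have [Y [hY hY1 hY2]] := hspace_of (row _ u) (row _ v)
  (sglue (@jval R) (fun t => (s1 t).1) (fun t => (s2 t).1)).
have [V [hV hV1 hV2]] := hspace_of (row _ (fun t => rim1 (Y1 t) (Y2 t) (u t)))
  (row _ (fun t => rim2 (Y1 t) (Y2 t) (v t)))
  (sglue (jell q) (fun t => (s1 t).2) (fun t => (s2 t).2)).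
have sides p (F : hspace a b n m) : (forall t, aeq (- a) b (hpart t F) (glue p t)) ->
    forall t, aeq (- a) 0 (hpart t F) (p (Y1 t)) /\ aeq 0 b (hpart t F) (p (Y2 t)).
  move=> h t; split.
    exact: aeq_trans (aeq_sub (lexx _) (ltW hb) (h t)) (aeq_sym (aeq_in (glue1 p t))).
  exact: aeq_trans (aeq_sub (ltW na0) (lexx _) (h t)) (aeq_sym (aeq_in (glue2 p t))).
have sY := sides _ _ hY; have sV := sides _ _ hV.
have vY t : vpart t (hv1 Y) = u t /\ vpart t (hv2 Y) = v t by rewrite hY1 hY2 !rowE.
have vV t : vpart t (hv1 V) = rim1 (Y1 t) (Y2 t) (u t) /\ vpart t (hv2 V) = rim2 (Y1 t) (Y2 t) (v t).
  by rewrite hV1 hV2 !rowE.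
exists Y, V; split=> //; apply: opL_of_parts => t.
have [-> ->] := vY t; have [-> ->] := vV t.
by exists (Y1 t), (Y2 t).
Qed.

(** Testing with real functions and vectors, for which the real and the
    imaginary part of the adjoint identity are the two real adjoint identities. *)
Lemma adjoint_L (Z W : hspace a b n m) : adjoint L Z W -> L Z W.
Proof.
move=> adj; apply: opL_of_parts.
have sh (F : hspace a b n m) t : sqsummable_on (- a) b (fpart t (hfun F)) by rewrite fpart_hfun; exact: hpart_sq.
have pair t : adjoint_pair a b q (cos alpha) (sin alpha) (cos beta) (sin beta) (0 < eta) (0 < kappa)
    th1 th2 w1 D1 w2 D2 (hpart t Z) (hpart t W) (vpart t (hv1 Z)) (vpart t (hv2 Z))
    (vpart t (hv1 W)) (vpart t (hv2 W)).
  move=> Y1 Y2 u v dY.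
  pose J (Y : jet R) (s : bool) := if s then zero_jet else Y.
  pose U k (w : 'I_k -> R) (s : bool) := if s then (fun=> 0) else w.
  have [|Y [V [LYV hY hV vY vV]]] := @element_of (J Y1) (J Y2) (U _ u) (U _ v).
    by case; [exact: dom_zero|exact: dY].
  have dJ s : rdom (J Y1 s) (J Y2 s) (U _ u s) (U _ v s) by case: s; [exact: dom_zero|exact: dY].
  have rJ1 s : jreg (- a) 0 (J Y1 s) by case: (dJ s).
  have rJ2 s : jreg 0 b (J Y2 s) by case: (dJ s).
  have sq1 s := jreg_sq (ltW na0) hq1 (rJ1 s); have sq2 s := jreg_sq (ltW hb) hq2 (rJ2 s).
  have RV s t' := rform_aeq (vpart s (hv1 V)) (vpart s (hv2 V)) (vpart t' (hv1 Z)) (vpart t' (hv2 Z))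
    (hpart_sq s V) (hpart_sq t' Z) (sq1 s).2 (sq2 s).2 (hV s).1 (hV s).2.
  have RY s t' := rform_aeq (vpart s (hv1 Y)) (vpart s (hv2 Y)) (vpart t' (hv1 W)) (vpart t' (hv2 W))
    (hpart_sq s Y) (hpart_sq t' W) (sq1 s).1 (sq2 s).1 (hY s).1 (hY s).2.
  have zV t' : rform a b (hpart true V) (vpart true (hv1 V)) (vpart true (hv2 V))
      (hpart t' Z) (vpart t' (hv1 Z)) (vpart t' (hv2 Z)) = 0.
    rewrite RV (vV true).1 (vV true).2 !rdot_rank1 !rdot0 /= !int_on0; last 2 first.
    - by move=> x; rewrite /jell /=; ring.
    - by move=> x; rewrite /jell /=; ring.
    by rewrite /P1 /P2 /= !subrr !if_same; ring.
  have zY t' : rform a b (hpart true Y) (vpart true (hv1 Y)) (vpart true (hv2 Y))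
      (hpart t' W) (vpart t' (hv1 W)) (vpart t' (hv2 W)) = 0.
    rewrite RY (vY true).1 (vY true).2 !rdot0 /= !int_on0; [ring|..]; by move=> x; rewrite /= mul0r.
  have E := adj _ _ LYV.
  have key : rform a b (hpart false V) (vpart false (hv1 V)) (vpart false (hv2 V))
      (hpart t Z) (vpart t (hv1 Z)) (vpart t (hv2 Z)) =
    rform a b (hpart false Y) (vpart false (hv1 Y)) (vpart false (hv2 Y))
      (hpart t W) (vpart t (hv1 W)) (vpart t (hv2 W)).
    case: (t).
      have := congr1 (cpart true) E; rewrite /inner !pre_inner_im // !fpart_hfun zV zY !sub0r.
      exact: oppr_inj.
    by have := congr1 (cpart false) E; rewrite /inner !pre_inner_re // !fpart_hfun zV zY !addr0.
  by move: key; rewrite RV RY (vV false).1 (vV false).2 (vY false).1 (vY false).2.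
move=> t.
have [Z1 [Z2 [dZ f1 f2 [l1 l2] [e1 e2]]]] := adjoint_pair_dom ha hb hq1 hq2
  (sub1 (hpart_sq t Z)) (sub2 (hpart_sq t Z)) (sub1 (hpart_sq t W)) (sub2 (hpart_sq t W)) (pair t).
exists Z1, Z2; split=> //.
by split; apply: aeq_in => x _; rewrite ?l1 ?l2.
Qed.

Lemma L_dense : densely_defined L.
Proof.
move=> Y e e0.
have e20 : 0 < e ^+ 2 / 2 by rewrite divr_gt0 // exprn_gt0.
have /choice[Y1 /choice[Y2 h12]] : forall t, exists Y1, exists Y2,
  rdom Y1 Y2 (vpart t (hv1 Y)) (vpart t (hv2 Y)) /\
    int_on (- a) 0 (fun x => (hpart t Y x - jval Y1 x) ^+ 2) + int_on 0 b (fun x => (hpart t Y x - jval Y2 x) ^+ 2) < e ^+ 2 / 2.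
  move=> t; apply: dom_dense => //; [exact: sub1 (hpart_sq t Y)|exact: sub2 (hpart_sq t Y)].
have [Z [W [LZW hZ _ vZ _]]] := element_of (fun t => (h12 t).1).
exists Z; split; first by exists W.
have row_ext k (v w : 'rV[R[i]]_k) : (forall t, vpart t v = vpart t w) -> v = w.
  by move=> vw; apply/rowP => i; apply: eq_cparts => t; exact: (congr1 (fun h => h i) (vw t)).
have v1E : hv1 Y = hv1 Z by apply: row_ext => t; rewrite (vZ t).1.
have v2E : hv2 Y = hv2 Z by apply: row_ext => t; rewrite (vZ t).2.
have dE t : fpart t (fun x => hfun Y x - hfun Z x) = fun x => hpart t Y x - hpart t Z x.
  by apply/funext => x; rewrite -!fpart_hfun /fpart cpartB.
have sd t : sqsummable_on (- a) b (fpart t (fun x => hfun Y x - hfun Z x)).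
  by rewrite dE; apply: sqB; exact: hpart_sq.
have small t : rform a b (fpart t (fun x => hfun Y x - hfun Z x)) (@vpart R n t 0) (@vpart R m t 0)
    (fpart t (fun x => hfun Y x - hfun Z x)) (@vpart R n t 0) (@vpart R m t 0) < e ^+ 2 / 2.
  have v0 k : @vpart R k t 0 = fun=> 0 by apply/funext => i; rewrite /vpart mxE cpart0.
  rewrite /rform !v0 !rdot0 !addr0; apply: le_lt_trans (h12 t).2; rewrite le_eqVlt; apply/predU1P; left.
  have [[[hY1 _ _] [hY2 _ _] _ _ _ _] _] := h12 t.
  have aux l r (y : R -> R) : sqsummable_on l r (fpart t (fun x => hfun Y x - hfun Z x)) -> sqsummable_on l r (hpart t Y) ->
      sqsummable_on l r y -> aeq l r (hpart t Z) y ->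
      int_on l r (fun x => fpart t (fun x => hfun Y x - hfun Z x) x * fpart t (fun x => hfun Y x - hfun Z x) x) =
      int_on l r (fun x => (hpart t Y x - y x) ^+ 2).
    move=> [md _] [mY _] [my _] Zy; apply: aeq_int.
    - rewrite dE; apply: (aeq2 (fun u v => (u - v) * (u - v)) (aeq_refl _ _ _) Zy).
    - exact: measurable_funM.
    - by apply: measurable_funX; exact: measurable_funB.
  rewrite (aux _ _ _ (sub1 (sd t)) (sub1 (hpart_sq t Y)) (abscont_sq (ltW na0) hY1) (hZ t).1).
  by rewrite (aux _ _ _ (sub2 (sd t)) (sub2 (hpart_sq t Y)) (abscont_sq (ltW hb) hY2) (hZ t).2).
rewrite /hdist v1E v2E !subrr -[complex.Re _]/(cpart false _) pre_inner_re //.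
rewrite -[ltRHS]ger0_norm ?(ltW e0) // -sqrtr_sqr ltr_sqrt ?exprn_gt0 //.
by have := small false; have := small true; lra.
Qed.

Theorem L_self_adjoint : self_adjoint L.
Proof.
split; first exact: L_dense.
move=> Z W; split; last exact: adjoint_L.
by move=> LZW Y V LYV; exact: L_symmetric.
Qed.

End Complexification.

Theorem theorem5p1 (R : realType)
    (a b : R) (ha : 0 < a) (hb : 0 < b)
    (q : R -> R) (hq : L2on (- a) b q)
    (alpha beta : R) (halpha : 0 <= alpha < pi) (hbeta : 0 < beta <= pi)
    (N M : nat) (eta kappa xi zeta : R) (heta : 0 <= eta) (hkappa : 0 <= kappa)
    (c : 'I_N -> R) (hc : forall i j : 'I_N, (i < j)%N -> c i < c j)
    (d : 'I_M -> R) (hd : forall i j : 'I_M, (i < j)%N -> d i < d j)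
    (bv : 'I_N -> R) (hbv : forall i, 0 < bv i)
    (av : 'I_M -> R) (hav : forall j, 0 < av j)
    (N' : nat) (sigma : R) (gamma betav : 'I_N' -> R)
    (hmu : 0 < eta -> mu_inv_expansion eta xi bv c sigma betav gamma)
    (M' : nat) (tau : R) (delta alphav : 'I_M' -> R)
    (hnu : 0 < kappa -> nu_inv_expansion kappa zeta av d tau alphav delta) :
  self_adjoint
    (@opL R a b q alpha beta N M N' M' eta kappa xi zeta c bv d av
       sigma gamma betav tau delta alphav).
Proof.
exact: (L_self_adjoint ha hb ((L2onP _ _ _).1 hq)).
Qed.
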